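(* Let $n\in\mathbb{N}$ and suppose $\boldsymbol{h}\ne\boldsymbol{0}$. Let $\langle\cdot\rangle_{\beta,h}$ be the (normalised) expectation of the $\mathbb{R}^n$ model on $\Lambda$, and let $\mathbb{E}^h_{i,\boldsymbol{\ell}}$ be the (deficient) expectation of the killed simple random walk with killing rates $\boldsymbol{h}$. Let $g\colon\mathbb{R}^\Lambda\to\mathbb{R}$ have moderate growth, let $a\in\Lambda$, and let $s\in\mathbb{R}$. Then $$\Big\langle(\theta_su_a^1)\,g\big(\tfrac12|\theta_s\boldsymbol{u}|^2\big)\Big\rangle_{\beta,h}=s\sum_{i\in\Lambda}h_i\Big\langle\int_0^\infty\mathbb{E}^h_{i,\frac12|\theta_s\boldsymbol{u}|^2}\big(g(\boldsymbol{L}_t)1_{X_t=a}\big)\,dt\Big\rangle_{\beta,h}.$$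
   Context: $\Lambda$ is a finite set, $\beta=(\beta_{ij})_{i,j\in\Lambda}$ are edge weights with $\beta_{ij}=\beta_{ji}\ge0$ such that the graph with vertex set $\Lambda$ and edge set $\{\{i,j\}\mid\beta_{ij}>0\}$ is connected, and $\boldsymbol{h}=(h_i)_{i\in\Lambda}$ with $h_i\ge0$. Bold symbols denote objects indexed by $\Lambda$; functions are Borel measurable. $g$ has moderate growth if it grows at most polynomially: $|g(\boldsymbol{\ell})|\le C(1+|\boldsymbol{\ell}|)^q$ for some $C,q$. For $\boldsymbol{u}=(u_i)_{i\in\Lambda}\in(\mathbb{R}^n)^\Lambda$ let $|\boldsymbol{u}|^2=(u_i\cdot u_i)_{i\in\Lambda}$, $H_{\beta,h}(\boldsymbol{u})=\frac14\sum_{i,j\in\Lambda}\beta_{ij}|u_i-u_j|^2+\frac12\sum_{i\in\Lambda}h_i|u_i|^2$, $[F]_{\beta,h}=\int_{(\mathbb{R}^n)^\Lambda}F(\boldsymbol{u})e^{-H_{\beta,h}(\boldsymbol{u})}\,d\boldsymbol{u}$, and $\langle F\rangle_{\beta,h}=[F]_{\beta,h}/[1]_{\beta,h}$. $\theta_s\boldsymbol{u}=(u_i+se^1)_{i\in\Lambda}$ with $e^1=(1,0,\dots,0)\in\mathbb{R}^n$; so $\theta_su_a^1=u_a^1+s$. Simple random walk: $X_t$ is the Markov jump process on $\Lambda$ jumping from $i$ to $j$ at rate $\beta_{ij}$; $L_t^i=L_0^i+\int_0^t1_{X_r=i}\,dr$; under $\mathbb{E}_{i,\boldsymbol{\ell}}$,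 $X_0=i$, $\boldsymbol{L}_0=\boldsymbol{\ell}$. The killed walk is in addition killed at rate $h_i$ at $i$; its deficient expectation is $\mathbb{E}^h_{i,\boldsymbol{\ell}}(f(X_t,\boldsymbol{L}_t))=\mathbb{E}_{i,\boldsymbol{\ell}}\big(f(X_t,\boldsymbol{L}_t)e^{-\sum_jh_j(L_t^j-\ell_j)}\big)$. *)

(* Defs.v *)
From HB Require Import structures.
From mathcomp Require Import all_boot all_order all_algebra.
From mathcomp Require Import all_classical all_reals all_analysis.
Import Order.TTheory GRing.Theory Num.Theory.
Import numFieldNormedType.Exports.

Set Implicit Arguments.
Unset Strict Implicit.
Unset Printing Implicit Defensive.

Local Open Scope classical_set_scope.
Local Open Scope ring_scope.

(* The library has binary product measures only; [tuple_measure mu k] is the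
   k-fold product of [mu] on [k.-tuple T], obtained by transporting
   [mu \x tuple_measure mu k'] along [cons]. *)
Section tuple_measure.
Context d (T : measurableType d) (R : realType).

Definition cons_pair k (p : T * k.-tuple T) : k.+1.-tuple T :=
  [the k.+1.-tuple T of p.1 :: p.2].

Lemma measurable_cons_pair k : measurable_fun setT (@cons_pair k).
Proof. exact: measurable_cons. Qed.

Section step.
Variables (mu : {sigma_finite_measure set T -> \bar R}).
Variables (k : nat) (m : {sigma_finite_measure set (k.-tuple T) -> \bar R}).

Definition tuple_measureS : set (k.+1.-tuple T) -> \bar R :=
  pushforward (mu \x m)%E (@cons_pair k).

Let tuple_measureS0 : tuple_measureS set0 = 0%E.
Proof. by rewrite /tuple_measureS /pushforward preimage_set0 measure0. Qed.

Let tuple_measureS_ge0 A : (0 <= tuple_measureS A)%E.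
Proof. by rewrite /tuple_measureS /pushforward measure_ge0. Qed.

Let tuple_measureS_sigma_additive : semi_sigma_additive tuple_measureS.
Proof.
move=> F mF tF mUF; rewrite /tuple_measureS /pushforward preimage_bigcup.
apply: measure_semi_sigma_additive.
- by move=> n; rewrite -[X in measurable X]setTI; exact: measurable_cons_pair.
- apply/trivIsetP => /= i j _ _ ij; rewrite -preimage_setI.
  by move/trivIsetP : tF => /(_ _ _ _ _ ij) ->//; rewrite preimage_set0.
- rewrite -preimage_bigcup -[X in measurable X]setTI.
  exact: measurable_cons_pair.
Qed.

HB.instance Definition _ := isMeasure.Build _ _ _ tuple_measureS
  tuple_measureS0 tuple_measureS_ge0 tuple_measureS_sigma_additive.

Let tuple_measureS_sigma_finite : sigma_finite setT tuple_measureS.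
Proof.
pose uncons (t : k.+1.-tuple T) : T * k.-tuple T :=
  (thead t, [tuple of behead t]).
have consK p : uncons (@cons_pair k p) = p.
  by case: p => x t; congr (_, _); exact/val_inj.
have munc : measurable_fun setT uncons.
  apply: measurable_fun_pair; first exact: measurable_tnth.
  exact: measurable_behead.
have /sigma_finiteP[F [TF ndF Foo]] := sigma_finiteT mu.
have /sigma_finiteP[G [TG ndG Goo]] := sigma_finiteT m.
exists (fun i => uncons @^-1` (F i `*` G i)).
  rewrite -preimage_bigcup; apply/esym; rewrite -subTset => t _ /=.
  have : setT (uncons t).1 by [].
  have : setT (uncons t).2 by [].
  rewrite TF TG => -[j _ Gj] [i _ Fi]; exists (maxn i j) => //; split.
    by move: Fi; exact/subsetPset/ndF/leq_maxl.
  by move: Gj; exact/subsetPset/ndG/leq_maxr.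
move=> i; have [mF Fi] := Foo i; have [mG Gi] := Goo i; split.
  by rewrite -[X in measurable X]setTI; apply: munc => //; exact: measurableX.
rewrite /tuple_measureS /pushforward.
rewrite (_ : _ @^-1` _ = F i `*` G i); last first.
  by apply/funext => p; rewrite -[in RHS](consK p).
by rewrite product_measure1E// lte_mul_pinfty// ge0_fin_numE.
Qed.

HB.instance Definition _ := Measure_isSigmaFinite.Build _ _ _
  tuple_measureS tuple_measureS_sigma_finite.

End step.

Fixpoint tuple_measure (mu : {sigma_finite_measure set T -> \bar R}) k :
    {sigma_finite_measure set (k.-tuple T) -> \bar R} :=
  if k is k'.+1 then tuple_measureS mu (tuple_measure mu k')
  else \d_([tuple] : 0.-tuple T).

End tuple_measure.

Section spins.
Context {R : realType} {Lam : finType}.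

(* Borel structure and Lebesgue measure on [I -> R] are transported from
   [#|I|.-tuple R]; neither depends on the enumeration of [I]. *)
Definition of_tuple (I : finType) (t : #|I|.-tuple R) : I -> R :=
  fun i => tnth t (enum_rank i).

Definition borel_fun (I : finType) (f : (I -> R) -> R) : Prop :=
  measurable_fun [set: #|I|.-tuple (measurableTypeR R)]
    (fun t => f (of_tuple t) : measurableTypeR R).

Definition moderate_growth (I : finType) (g : (I -> R) -> R) : Prop :=
  exists (C : R) (q : nat), forall l : I -> R,
    `|g l| <= C * (1 + Num.sqrt (\sum_i l i ^+ 2)) ^+ q.

Section model.
Variable n : nat.
Implicit Types u : Lam -> 'rV[R]_n.+1.

Definition dot (x y : 'rV[R]_n.+1) : R := \sum_k x 0 k * y 0 k.

Definition sq_norms u : Lam -> R := fun i => dot (u i) (u i).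

Definition half_sq_norms u : Lam -> R := fun i => 2^-1 * sq_norms u i.

Definition hamiltonian (beta : Lam -> Lam -> R) (h : Lam -> R) u : R :=
  4^-1 * (\sum_i \sum_j beta i j * dot (u i - u j) (u i - u j)) +
  2^-1 * (\sum_i h i * dot (u i) (u i)).

Definition config (t : #|{: Lam * 'I_n.+1}|.-tuple R) : Lam -> 'rV[R]_n.+1 :=
  fun i => \row_k of_tuple t (i, k).

Definition bracket beta h (F : (Lam -> 'rV[R]_n.+1) -> \bar R) : \bar R :=
  (\int[tuple_measure (@lebesgue_measure R) #|{: Lam * 'I_n.+1}|]_t
     (F (config t) * (expR (- hamiltonian beta h (config t)))%:E))%E.

Definition spin_expectation beta h (F : (Lam -> 'rV[R]_n.+1) -> \bar R) :
  \bar R := (bracket beta h F / bracket beta h (cst 1))%E.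

Definition e1 : 'rV[R]_n.+1 := delta_mx 0 ord0.

Definition theta (s : R) u : Lam -> 'rV[R]_n.+1 := fun i => u i + s *: e1.

End model.

(* [p t i j] is the probability of moving from i to j in time t; [tf_rate]
   says that jumps from i to j occur at rate [beta i j].  The diagonal entries
   of [beta] play no role. *)
Record transition_function (beta : Lam -> Lam -> R) (p : R -> Lam -> Lam -> R)
    : Prop := {
  tf_ge0 : forall t i j, 0 <= t -> 0 <= p t i j;
  tf_sum1 : forall t i, 0 <= t -> \sum_j p t i j = 1;
  tf_0 : forall i j, p 0 i j = (i == j)%:R;
  tf_chapman_kolmogorov : forall r t i j, 0 <= r -> 0 <= t ->
    p (r + t) i j = \sum_k p r i k * p t k j;
  tf_rate : forall i j, i != j -> p t i j / t @[t --> 0^'+] --> beta i j }.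

(* Probability of visiting x_1 at time t_1, ..., x_m at time t_m, for
   s = [:: (t_1, x_1); ...; (t_m, x_m)], when starting from i at time r. *)
Fixpoint path_prob (p : R -> Lam -> Lam -> R) (r : R) (i : Lam)
    (s : seq (R * Lam)) : R :=
  if s is (t, j) :: s' then p (t - r) i j * path_prob p t j s' else 1.

Section walk.
Context d (Om : measurableType d).
Implicit Types (P : Lam -> probability Om R) (X : R -> Om -> Lam).

(* [P i] is the law of the walk started from i.  Only times t >= 0 matter. *)
Record random_walk (beta : Lam -> Lam -> R) P X : Prop := {
  rw_measurable : forall t i, 0 <= t -> measurable [set w | X t w = i];
  rw_right_continuous : forall w t, 0 <= t ->
    \forall r \near t^'+, X r w = X t w;
  rw_left_limit : forall w t, 0 < t ->
    exists j, \forall r \near t^'-, X r w = j;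
  rw_markov : exists2 p, transition_function beta p &
    forall i (s : seq (R * Lam)), path <=%R 0 (unzip1 s) ->
      P i [set w | forall q, q \in s -> X q.1 w = q.2] =
      (path_prob p 0 i s)%:E }.

Definition local_time X (l : Lam -> R) (t : R) (w : Om) : Lam -> R :=
  fun i => l i + \int[lebesgue_measure]_(r in `[0, t]) (X r w == i)%:R.

Definition killed_expectation (h : Lam -> R) P X (i : Lam) (l : Lam -> R)
    (f : Lam -> (Lam -> R) -> R) (t : R) : \bar R :=
  'E_(P i)[fun w => (f (X t w) (local_time X l t w) *
             expR (- \sum_j h j * (local_time X l t w j - l j)))%R]%E.

End walk.
End spins.

(* Main.v *)
Require Import Defs.
From HB Require Import structures.
From mathcomp Require Import all_boot all_order all_algebra.
From mathcomp Require Import all_classical all_reals all_analysis.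
From mathcomp Require Import measurable_realfun ring lra.
Import Order.TTheory GRing.Theory Num.Theory.
Import numFieldNormedType.Exports.

(* Take first g(l) = exp(-(K,l)) with K >= 1 at every site.  By the Feynman-Kac
   formula the time integral on the right-hand side is G_ia exp(-(K,l)), where
   G is the inverse of h + K - Delta_beta.  On the left-hand side the density
   exp(-H(u) - (K, |theta_s u|^2 / 2)) is Gaussian in u; its centre is -m e^1
   with m = s - s h G, so the mean of u_a^1 + s is s - m_a = s (h G)_a times the
   total mass.  Hence both sides agree for these g.

   The difference of the two sides, with the weight exp(-sum_i l_i) put into the
   measures, is the integral of g against a finite signed measure carried by the
   orthant.  It vanishes on exponentials, hence on bounded Borel functions.
   Functions of moderate growth are reached by truncation: applied to |g| the
   identity bounds the right-hand side by a Gaussian integral, so dominated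
   convergence applies. *)

Set Implicit Arguments.
Unset Strict Implicit.
Unset Printing Implicit Defensive.

Local Open Scope classical_set_scope.
Local Open Scope ring_scope.

(** * Uniqueness of Laplace transforms on the orthant *)

(** The test exponents satisfy K >= 1 because h may vanish at all sites but one: the total killing
    rate h + K is then at least 1 everywhere, so the killed semigroup is bounded by exp(-t) and its
    time integral converges whatever h is.

    No Gaussian integral is evaluated. The reflection u -> -u - 2 m e^1 preserves the tilted weight,
    so u_a^1 + m_a has mean zero, and the total mass stays as an unevaluated factor common to both
    sides. That -m e^1 is the centre amounts to (h + K - Delta_beta) m = s K; since Delta_beta kills
    constants, the formula for m follows from G being the inverse matrix.

    The obstacle is that nothing is known beforehand about integrability on the right-hand side for
    unbounded g. The bound drawn from the identity for truncations of |g| controls the i-th summand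
    only after division by |s| h_i. Where this coefficient vanishes, the summand vanishes too, by
    the convention that 0 times an infinite value is 0. *)

Section exponential_convergence.
Variable R : realType.
Implicit Types a c x y : R.

(** A bound uniform in n: it dominates the partial sums when an exponential series is passed through
    a normal functional. *)
Lemma norm_series_exp_coeff y n : `|series (exp_coeff y) n| <= expR `|y|.
Proof.
apply: le_trans (ler_norm_sum _ _ _) _.
have -> : \sum_(0 <= i < n) `|exp_coeff y i| = series (exp_coeff `|y|) n.
  by rewrite -normed_series_exp_coeff.
apply: nondecreasing_cvgn_le; last exact: is_cvg_series_exp_coeff.
apply/nondecreasing_seqP => m; rewrite seriesSr lerDl /exp_coeff.
by rewrite divr_ge0// exprn_ge0.
Qed.

Lemma mul_expR_cvgn0 y : 0 < y -> n%:R * expR (- (n%:R * y)) @[n --> \oo] --> (0 : R).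
Proof.
move=> y0.
have H : 0 @[n --> \oo] --> (0:R) by exact: cvg_cst.
have H2 : 2 / y ^+ 2 * harmonic n @[n --> \oo] --> (0 : R).
  rewrite -[X in _ --> X](mulr0 (2 / y ^+ 2)).
  by apply: cvgM; [exact: cvg_cst|exact: cvg_harmonic].
(* From exp(z) >= z^2 / 2 the sequence is at most 2 / (n y^2); two copies of the harmonic term
   appear because 1/n <= 2/(n+1) for n >= 1. *)
have H3 : 2 / y ^+ 2 * (n.+1%:R)^-1 + 2 / y ^+ 2 * (n.+1%:R)^-1 @[n --> \oo] --> (0 : R).
  rewrite -[X in _ --> X](addr0 0); exact: cvgD.
apply: (squeeze_cvgr _ H H3); near=> n; rewrite mulr_ge0 ?expR_ge0//=.
have n0 : 0 < n%:R :> R by rewrite ltr0n; near: n; exact: nbhs_infty_gt.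
have := expR_ge1Dxn 1 (mulr_ge0 (ler0n R n) (ltW y0)).
rewrite expRN => h.
have h2 : (n%:R * y) ^+ 2 / 2 <= expR (n%:R * y).
  by apply: le_trans h; rewrite lerDr.
rewrite ler_pdivrMr ?expR_gt0//.
apply: le_trans (ler_wpM2l _ h2); last first.
  by rewrite addr_ge0// mulr_ge0// divr_ge0// exprn_ge0// ltW.
have y0' : y != 0 by rewrite gt_eqF.
have -> : (2 / y ^+ 2 * (n.+1%:R)^-1 + 2 / y ^+ 2 * (n.+1%:R)^-1) * ((n%:R * y) ^+ 2 / 2) =
   2 * n%:R ^+2 / n.+1%:R.
  by field; rewrite y0' addrC natr1 pnatr_eq0.
rewrite ler_pdivlMr// -natrX -!natrM ler_nat expnS expn1 mulnCA leq_mul2l.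
by rewrite mul2n -addnn -addn1 leq_add2l -(ltr0n R) n0 orbT.
Unshelve. all: by end_near. Qed.

(* The prefactor n forces the limit at x = c to be 0, so the limit is exactly
   an indicator function. *)
Lemma expR_expR_cvgn_indicator c x :
  (expR (- (n%:R * expR (- (n%:R * (x - c))))) : R) @[n --> \oo] --> ((c < x)%R%:R : R).
Proof.
have [cx|xc] := ltP c x.
  rewrite mulr1n -[X in _ --> X]expR0 -[X in _ --> expR X]oppr0.
  have h : (- (n%:R * expR (- (n%:R * (x - c)))) : R) @[n --> \oo] --> (- 0 : R).
    by apply: cvgN; apply: mul_expR_cvgn0; rewrite subr_gt0.
  exact: (continuous_cvg _ (@continuous_expR R _) h).
have H : 0 @[n --> \oo] --> (0:R) by exact: cvg_cst.
apply: (squeeze_cvgr _ H (@cvgn_expR R)); near=> n.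
rewrite expR_ge0 ler_expR lerN2; apply: ler_peMr => //.
by rewrite -[leLHS]expR0 ler_expR -mulrN mulr_ge0// oppr_ge0 subr_le0.
Unshelve. all: by end_near. Qed.

End exponential_convergence.

Section laplace_uniqueness.
Variables (R : realType) (k : nat).
Local Notation T := (k.-tuple (measurableTypeR R)).

Definition orthant : set T := [set x | forall i, 0 <= tnth x i].

Definition orthant_bounded (F : T -> R) :=
  measurable_fun setT F /\ exists C : R, forall x, orthant x -> `|F x| <= C.

(* Models [F |-> \int F dm] for a finite signed measure m carried by the orthant. *)
Record normal_functional (I : (T -> R) -> R) : Prop := {
  nf_linear : forall a F G, orthant_bounded F -> orthant_bounded G ->
    I (fun x => a * F x + G x) = a * I F + I G;
  nf_cvg : forall (F_ : nat -> T -> R) (F : T -> R) (C : R),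
    (forall n, measurable_fun setT (F_ n)) -> measurable_fun setT F ->
    (forall n x, orthant x -> `|F_ n x| <= C) ->
    (forall x, orthant x -> F_ ^~ x @ \oo --> F x) ->
    I (F_ n) @[n --> \oo] --> I F }.

Lemma orthant_bounded_cst a : orthant_bounded (cst a).
Proof. by split => //; exists `|a|. Qed.

Lemma orthant_bounded_lin a F G : orthant_bounded F -> orthant_bounded G ->
  orthant_bounded (fun x => a * F x + G x).
Proof.
move=> [mF [C FC]] [mG [C' GC']]; split.
  by apply: measurable_funD => //; exact: measurable_funM.
exists (`|a| * C + C') => x Dx; apply: le_trans (ler_normD _ _) _.
by rewrite lerD ?GC'// normrM ler_wpM2l// FC.
Qed.

Lemma orthant_bounded_cvg (F_ : nat -> T -> R) (F : T -> R) (C : R) :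
  (forall n, measurable_fun setT (F_ n)) -> measurable_fun setT F ->
  (forall n x, orthant x -> `|F_ n x| <= C) ->
  (forall x, orthant x -> F_ ^~ x @ \oo --> F x) -> orthant_bounded F.
Proof.
move=> mF_ mF FC FF; split => //; exists C => x Dx.
have h : `|F_ n x| @[n --> \oo] --> `|F x| by apply: cvg_norm; exact: FF.
rewrite -(cvg_lim (@norm_hausdorff _ _) h); apply: limr_le.
  by apply/cvg_ex; exists `|F x|.
by near=> n; exact: FC.
Unshelve. all: by end_near. Qed.

Definition exp_test (e : 'I_k -> R) : T -> R :=
  fun x => expR (- \sum_i e i * tnth x i).

Lemma measurable_exp_test e : measurable_fun setT (exp_test e).
Proof.
apply: measurableT_comp; first exact: measurable_expR.
apply: measurable_funN; apply: measurable_sum => i.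
apply: measurable_funM => //; exact: (@measurable_tnth _ (measurableTypeR R)).
Qed.

Lemma exp_test_le1 e x : (forall i, 0 <= e i) -> orthant x ->
  0 <= exp_test e x <= 1.
Proof.
move=> e0 Dx; rewrite expR_ge0 -expR0 ler_expR oppr_le0 sumr_ge0// => i _.
by rewrite mulr_ge0.
Qed.

Variable I : (T -> R) -> R.
Hypothesis nI : normal_functional I.
Hypothesis I0 : forall e : 'I_k -> R, (forall i, 0 <= e i) ->
  I (exp_test e) = 0.

(** The quantifier over e makes the class stable under multiplication by exp(-c x_i), which is
    absorbed into e. Starting from the constant 1, linear combinations and bounded limits then lead
    to the indicators of half-spaces and their products. *)
Let null F := orthant_bounded F /\
  forall e, (forall i, 0 <= e i) -> I (fun x => exp_test e x * F x) = 0.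

Lemma orthant_bounded_exp_test e F : (forall i, 0 <= e i) ->
  orthant_bounded F -> orthant_bounded (fun x => exp_test e x * F x).
Proof.
move=> e0 [mF [C FC]]; split.
  by apply: measurable_funM => //; exact: measurable_exp_test.
exists C => x Dx; have /andP[E0 E1] := exp_test_le1 e0 Dx.
by rewrite normrM (ger0_norm E0) (le_trans _ (FC _ Dx))// ler_piMl.
Qed.

Let null1 : null (cst 1).
Proof.
split; first exact: orthant_bounded_cst.
by move=> e e0; under eq_fun do rewrite mulr1; exact: I0.
Qed.

Let null_lin a F G : null F -> null G -> null (fun x => a * F x + G x).
Proof.
move=> [bF F0] [bG G0]; split; first exact: orthant_bounded_lin.
move=> e e0.
under eq_fun do rewrite mulrDr mulrCA.
by rewrite (nf_linear nI) ?F0 ?G0 ?mulr0 ?addr0//; exact: orthant_bounded_exp_test.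
Qed.

Let null_cvg (F_ : nat -> T -> R) (F : T -> R) (C : R) :
  (forall n, null (F_ n)) -> measurable_fun setT F ->
  (forall n x, orthant x -> `|F_ n x| <= C) ->
  (forall x, orthant x -> F_ ^~ x @ \oo --> F x) -> null F.
Proof.
move=> F0 mF FC FF; have mF_ n : measurable_fun setT (F_ n) := (F0 n).1.1.
split; first exact: orthant_bounded_cvg FC FF.
move=> e e0.
have mE := measurable_exp_test e.
have h : I (fun x => exp_test e x * F_ n x) @[n --> \oo] -->
    I (fun x => exp_test e x * F x).
  apply: (nf_cvg nI (C := C)).
  - by move=> n; exact: measurable_funM.
  - exact: measurable_funM.
  - move=> n x Dx; have /andP[E0 E1] := exp_test_le1 e0 Dx.
    by rewrite normrM (ger0_norm E0) (le_trans _ (FC n _ Dx))// ler_piMl.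
  - by move=> x Dx; apply: cvgM; [exact: cvg_cst|exact: FF].
have h0 : I (fun x => exp_test e x * F_ n x) @[n --> \oo] --> (0 : R).
  by under eq_fun do rewrite (F0 _).2//; exact: cvg_cst.
by rewrite -(cvg_lim (@norm_hausdorff _ _) h) (cvg_lim (@norm_hausdorff _ _) h0).
Qed.

Let coordinate_exp (c : R) i : T -> R := fun x => expR (- (c * tnth x i)).

Let measurable_coordinate_exp c i : measurable_fun setT (coordinate_exp c i).
Proof.
apply: measurableT_comp; first exact: measurable_expR.
apply: measurable_funN; apply: measurable_funM => //.
exact: (@measurable_tnth _ (measurableTypeR R)).
Qed.

Let coordinate_exp_le1 (c : R) i x : 0 <= c -> orthant x ->
  0 <= coordinate_exp c i x <= 1.
Proof.
by move=> c0 Dx; rewrite expR_ge0 -expR0 ler_expR oppr_le0 mulr_ge0.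
Qed.

Let null_exp (c : R) i F : 0 <= c -> null F ->
  null (fun x => coordinate_exp c i x * F x).
Proof.
move=> c0 [[mF [C FC]] F0]; split.
  split; first exact: measurable_funM.
  exists C => x Dx; have /andP[E0 E1] := coordinate_exp_le1 i c0 Dx.
  by rewrite normrM (ger0_norm E0) (le_trans _ (FC _ Dx))// ler_piMl.
move=> e e0; rewrite -(F0 (fun j => e j + c * (j == i)%:R)); last first.
  by move=> j; rewrite addr_ge0// mulr_ge0.
congr I; apply/funext => x; rewrite mulrA; congr (_ * _).
rewrite -expRD -opprD; congr (expR (- _)).
under [RHS]eq_bigr do rewrite mulrDl.
rewrite big_split/= (bigD1 i)//= [X in _ = _ + X](bigD1 i)//= eqxx mulr1.
by rewrite [X in _ = _ + (_ + X)]big1 ?addr0// => j /negPf ->; rewrite mulr0 mul0r.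
Qed.

(** The n-th term of the power series of exp(-a exp(-c x_i)) is a multiple of exp(-n c x_i), so the
    partial sums stay in the class; on the orthant they are bounded by exp(a). *)
Let null_exp_exp (a c : R) i F : 0 <= a -> 0 <= c -> null F ->
  null (fun x => expR (- (a * coordinate_exp c i x)) * F x).
Proof.
move=> a0 c0 nF; have [[mF [C FC]] F0] := nF.
pose G n x := series (exp_coeff (- (a * coordinate_exp c i x))) n * F x.
apply: (@null_cvg G _ (expR a * C)).
- elim=> [|n [bn IH]].
    have -> : G 0 = (fun x => -1 * F x + F x).
      by apply/funext => x; rewrite /G /series/= big_geq// mul0r mulN1r addNr.
    exact: null_lin.
  have -> : G n.+1 = (fun x => ((- a) ^+ n / n`!%:R) *
      (coordinate_exp (c *+ n) i x * F x) + G n x).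
    apply/funext => x; rewrite /G seriesSr mulrDl addrC; congr (_ + _).
    rewrite /exp_coeff/= -mulNr exprMn -expRM_natl mulrN mulr_natl -mulrnAl.
    by rewrite !mulrA; congr (_ * _); rewrite mulrAC.
  by apply: null_lin => //; apply: null_exp => //; rewrite mulrn_wge0.
- apply: measurable_funM => //; apply: measurableT_comp; first exact: measurable_expR.
  by apply: measurable_funN; exact: measurable_funM.
- move=> n x Dx; have /andP[E0 E1] := coordinate_exp_le1 i c0 Dx.
  rewrite normrM ler_pM// ?FC//; apply: le_trans (norm_series_exp_coeff _ _) _.
  by rewrite ler_expR normrN ger0_norm ?mulr_ge0// ler_piMr.
- move=> x Dx; apply: cvgM; last exact: cvg_cst.
  exact: is_cvg_series_exp_coeff.
Qed.

(** The double exponential that converges to the indicator of c < x_i has the form exp(-a exp(-n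
    x_i)) with a = n exp(n c), and a is nonnegative for every real c. *)
Let null_gt (c : R) i F : null F -> null (fun x => (c < tnth x i)%R%:R * F x).
Proof.
move=> nF; have [[mF [C FC]] F0] := nF.
pose G n x := expR (- (n%:R * expR (- (n%:R * (tnth x i - c))))) * F x.
apply: (@null_cvg G _ C).
- move=> n.
  have -> : G n = (fun x => expR (- (n%:R * expR (n%:R * c) *
      coordinate_exp n%:R i x)) * F x).
    apply/funext => x; rewrite /G /coordinate_exp; congr (expR (- _) * _).
    by rewrite -mulrA -expRD mulrBr opprB.
  by apply: null_exp_exp => //; rewrite mulr_ge0// expR_ge0.
- apply: measurable_funM => //.
  have -> : (fun x : T => (c < tnth x i)%R%:R) =
      (\1_([set x : T | c < tnth x i]) : T -> R).
    by apply/funext => x; rewrite indicE; congr (nat_of_bool _)%:R; apply/idP/idP; rewrite inE.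
  apply: measurable_indic; rewrite -[X in measurable X]setTI.
  apply: measurable_fun_ltr => //.
  exact: (@measurable_tnth _ (measurableTypeR R)).
- move=> n x Dx; rewrite normrM (ger0_norm (expR_ge0 _)).
  by rewrite (le_trans _ (FC _ Dx))// ler_piMl// -[leRHS]expR0 ler_expR oppr_le0.
- move=> x Dx; apply: cvgM; last exact: cvg_cst.
  exact: expR_expR_cvgn_indicator.
Qed.

(** Lists of constraints make intersection a concatenation: a coordinate may be constrained several
    times or not at all, and the empty list gives the whole space. *)
Let boxes : set (set T) := [set B | exists s : seq ('I_k * R),
  B = [set x | all (fun p => p.2 < tnth x p.1) s]].

Let boxes_setI : setI_closed boxes.
Proof.
move=> _ _ [s ->] [s' ->]; exists (s ++ s'); apply/seteqP; split => x/=.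
  by move=> [? ?]; rewrite all_cat; apply/andP.
by rewrite all_cat => /andP.
Qed.

Let boxes_measurable : measurable = <<s boxes >>.
Proof.
apply/seteqP; split.
- have : measurable_fun (setT : set (g_sigma_algebraType boxes))
      (id : g_sigma_algebraType boxes -> T).
    apply/measurable_fun_tnthP => i.
    apply: (measurability _ (RGenOInfty.measurableE R)).
    move=> _ [_ [c ->] <-]; rewrite setTI; apply: sub_sigma_algebra.
    exists [:: (i, c)]; apply/seteqP; split => x /=; rewrite in_itv/= ?andbT//.
  by move=> mid B mB; have := mid measurableT _ mB; rewrite setTI.
- apply: smallest_sub; first exact: sigma_algebra_measurable.
  move=> _ [s ->]; elim: s => [|p s IH] /=.
    by rewrite (_ : [set x | _] = setT)//; apply/seteqP; split.
  rewrite (_ : [set x | _] = [set x : T | p.2 < tnth x p.1] `&`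
     [set x | all (fun p => p.2 < tnth x p.1) s]); last first.
    by apply/seteqP; split => x/= => [/andP//|[-> ->]].
  apply: measurableI => //; rewrite -[X in measurable X]setTI.
  apply: measurable_fun_ltr => //.
  exact: (@measurable_tnth _ (measurableTypeR R)).
Qed.

Let I1 F : null F -> I F = 0.
Proof.
move=> [_ F0]; rewrite -(F0 (fun=> 0))//; congr I; apply/funext => x.
by rewrite /exp_test big1 ?oppr0 ?expR0 ?mul1r// => i _; rewrite mul0r.
Qed.

Let obI B : measurable B -> orthant_bounded (\1_B : T -> R).
Proof.
move=> mB; split; first exact: measurable_indic.
by exists 1 => x _; rewrite indicE; case: (x \in B); rewrite /= ?normr1 ?normr0.
Qed.

Lemma normal_functional_indic0 B : measurable B -> I (\1_B : T -> R) = 0.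
Proof.
move=> mB.
apply: (@dynkin_induction _ T boxes (fun B => I (\1_B : T -> R) = 0)) => //.
- by rewrite indicT; exact: I1 null1.
- move=> _ [s ->]; apply: I1.
  have -> : \1_([set x | all (fun p => p.2 < tnth x p.1) s]) =
      (fun x => \prod_(p <- s) (p.2 < tnth x p.1)%R%:R * cst 1 x) :> (T -> R).
    apply/funext => x; rewrite indicE /cst mulr1
      (_ : (_ \in _) = all (fun p => p.2 < tnth x p.1) s).
      elim: s => [|p s IH]/=; first by rewrite big_nil.
      by rewrite big_cons -IH; case: (_ < _); rewrite ?mul1r ?mul0r.
    by apply/idP/idP; rewrite inE.
  elim: s => [|p s IH]; first by under eq_fun do rewrite big_nil mul1r.
  by under eq_fun do rewrite big_cons -mulrA; exact: null_gt.
- move=> A mA A0.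
  have -> : \1_(~` A) = (fun x => -1 * \1_A x + cst 1 x) :> (T -> R).
    by apply/funext => x; rewrite !indicE in_setC; case: (x \in A);
      rewrite /= ?mulr1 ?mulr0 ?addNr ?add0r.
  rewrite (nf_linear nI) ?A0 ?mulr0 ?add0r; first exact: I1 null1.
    exact: obI.
  exact: orthant_bounded_cst.
- move=> F mF tF F0.
  (* Countable additivity: the indicators of the partial unions are eventually constant at each
     point and bounded by 1, so [nf_cvg] reduces the countable union to finite ones. *)
  pose G n : T -> R := \1_(\bigcup_(i < n) F i).
  have mU n : measurable (\bigcup_(i < n) F i) by exact: bigcup_measurable.
  have h : I (G n) @[n --> \oo] --> I (\1_(\bigcup_k F k)).
    apply: (nf_cvg nI (C := 1)).
    + by move=> n; exact: measurable_indic.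
    + by apply: measurable_indic; exact: bigcup_measurable.
    + by move=> n x _; rewrite /G indicE; case: (_ \in _); rewrite /= ?normr1 ?normr0.
    + move=> x _; apply: cvg_near_cst; rewrite /G.
      have [[n _ Fnx]|nF] := pselect ((\bigcup_k F k) x).
        near=> m; rewrite !indicE !mem_set//; first by exists n.
        by exists n => //=; near: m; exact: nbhs_infty_gt.
      near=> m; rewrite !indicE !memNset// => -[i _ Fi]; apply: nF.
      by exists i.
  have h0 : I (G n) @[n --> \oo] --> (0 : R).
    suff -> : (fun n => I (G n)) = (fun=> 0) by exact: cvg_cst.
    apply/funext; elim=> [|n IH].
      rewrite /G II0 bigcup_set0 (_ : \1_set0 = (fun x => -1 * cst 1 x + cst 1 x)); last first.
        by apply/funext => x; rewrite indicE in_set0 /cst mulr1 addNr.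
      rewrite (nf_linear nI); [|exact: orthant_bounded_cst..].
      by rewrite (I1 null1) mulr0 addr0.
    have -> : G n.+1 = (fun x => 1 * \1_(F n) x + G n x).
      apply/funext => x; rewrite mul1r /G !indicE -natrD; congr (_%:R).
      have [xn|xn] := boolP (x \in F n).
        rewrite mem_set; last by exists n => //=; rewrite inE in xn.
        rewrite memNset// => -[i/= ltin Fi]; move/trivIsetP : tF => /(_ i n Logic.I Logic.I).
        rewrite ltn_eqF// => /(_ isT) /seteqP[+ _] => /(_ x); apply; split => //.
        by rewrite inE in xn.
      rewrite add0n; congr nat_of_bool; apply/idP/idP; rewrite !inE => -[i/= ltin Fi].
        exists i => //=; move: ltin; rewrite ltnS leq_eqVlt => /predU1P[iE|//].
        by move: xn; rewrite notin_setE -iE.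
      by exists i => //=; exact: ltnW.
    by rewrite (nf_linear nI) ?F0 ?IH ?mulr0 ?addr0//; exact: obI.
  by rewrite -(cvg_lim (@norm_hausdorff _ _) h) (cvg_lim (@norm_hausdorff _ _) h0).
- by rewrite -boxes_measurable.
Unshelve. all: by end_near. Qed.

Import HBNNSimple.

(** Simple functions below F converge to it and inherit its bound; each is a finite combination of
    indicators, already known to be annihilated. *)
Let normal_functional_ge0 (F : T -> R) C : measurable_fun setT F ->
  (forall x, 0 <= F x <= C) -> I F = 0.
Proof.
move=> mF FC.
have mF' : measurable_fun setT (EFin \o F) by exact/measurable_EFinP.
pose G n : T -> R := nnsfun_approx measurableT mF' n.
have GF n x : 0 <= G n x <= F x.
  rewrite /G fun_ge0/= -lee_fin nnsfun_approxE.
  by apply: le_approx => // y _; rewrite lee_fin; case/andP: (FC y).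
have h : I (G n) @[n --> \oo] --> I F.
  apply: (nf_cvg nI (C := C)) => //.
    move=> n x _; have /andP[g0 gF] := GF n x; rewrite ger0_norm//.
    by rewrite (le_trans gF)//; case/andP: (FC x).
  move=> x _.
  have := @cvg_nnsfun_approx _ _ _ _ measurableT _ mF' (fun y _ => _) x Logic.I.
  by move=> /(_ (fun y => _)) /fine_cvg; apply => y; rewrite lee_fin; case/andP: (FC y).
have h0 : I (G n) @[n --> \oo] --> (0 : R).
  suff -> : (fun n => I (G n)) = (fun=> 0) by exact: cvg_cst.
  apply/funext => n; rewrite /G; set g := nnsfun_approx _ _ _.
  pose r : seq R := finmap.enum_fset (fset_set (range g)).
  have -> : (g : T -> R) = (fun x => \sum_(y <- r) y * \1_(g @^-1` [set y]) x).
    apply/funext => x; by rewrite fimfunE fsbig_finite.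
  suff [] : orthant_bounded (fun x => \sum_(y <- r) y * \1_(g @^-1` [set y]) x) /\
      I (fun x => \sum_(y <- r) y * \1_(g @^-1` [set y]) x) = 0 by [].
  elim: r => [|y s [bs IH]].
    under eq_fun do rewrite big_nil; split; first exact: orthant_bounded_cst.
    have -> : (fun=> 0) = (fun x => -1 * cst 1 x + cst 1 x) :> (T -> R).
      by apply/funext => x; rewrite /cst mulr1 addNr.
    rewrite (nf_linear nI); [|exact: orthant_bounded_cst..].
    by rewrite (I1 null1) mulr0 addr0.
  have my : measurable (g @^-1` [set y]) by exact: measurable_funPTI.
  under eq_fun do rewrite big_cons; split.
    by apply: orthant_bounded_lin => //; exact: obI.
  by rewrite (nf_linear nI) ?IH ?addr0 ?normal_functional_indic0 ?mulr0//; exact: obI.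
by rewrite -(cvg_lim (@norm_hausdorff _ _) h) (cvg_lim (@norm_hausdorff _ _) h0).
Qed.

Theorem normal_functional0 F : orthant_bounded F -> I F = 0.
Proof.
move=> [mF [C FC]].
pose M := Num.max C 0.
pose Fp x : R := Num.min M (Num.max (F x) 0).
pose Fm x : R := Num.min M (Num.max (- F x) 0).
have M0 : 0 <= M by rewrite le_max lexx orbT.
have mFp : measurable_fun setT Fp by apply: measurable_minr => //; exact: measurable_maxr.
have mFm : measurable_fun setT Fm.
  apply: measurable_minr => //; apply: measurable_maxr => //; exact: measurable_funN.
have bp x : 0 <= Fp x <= M by rewrite /Fp le_min M0 le_max lexx orbT ge_min lexx.
have bm x : 0 <= Fm x <= M by rewrite /Fm le_min M0 le_max lexx orbT ge_min lexx.
have oF : orthant_bounded F by split => //; exists C.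
have oFp : orthant_bounded Fp.
  by split => //; exists M => x _; case/andP: (bp x) => ? ?; rewrite ger0_norm.
have oFm : orthant_bounded Fm.
  by split => //; exists M => x _; case/andP: (bm x) => ? ?; rewrite ger0_norm.
have Ipm : I (fun x => -1 * Fm x + Fp x) = 0.
  by rewrite (nf_linear nI)// (normal_functional_ge0 mFp bp)
    (normal_functional_ge0 mFm bm) mulr0 addr0.
(* Off the orthant F need not be bounded and may differ from [Fp - Fm]. A constant sequence in
   [nf_cvg] shows that [I] depends only on the values on the orthant, where the two agree. *)
have h : I (fun x => -1 * Fm x + Fp x) @[n --> \oo] --> I F.
  apply: (nf_cvg nI (C := M + M)) => //.
  - by move=> _; apply: measurable_funD => //; exact: measurable_funM.
  - move=> _ x _; rewrite (le_trans (ler_normD _ _))// mulN1r normrN.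
    by case/andP: (bp x) => ? ?; case/andP: (bm x) => ? ?; rewrite !ger0_norm// lerD.
  - move=> x Dx; apply: cvg_near_cst; apply: nearW => _.
    have := FC _ Dx; rewrite ler_norml => /andP[h1 h2].
    have FM : F x <= M by rewrite le_max h2.
    have NFM : - F x <= M by rewrite le_max lerNl h1.
    rewrite /Fp /Fm; case: (leP 0 (F x)) => F0.
      rewrite !(min_idPr _) ?ge_max ?NFM ?FM//.
      by rewrite [Num.max (- _) _]max_r ?oppr_le0// mulr0 add0r.
    rewrite !(min_idPr _) ?ge_max ?NFM ?FM//.
    by rewrite [Num.max (- _) _]max_l ?oppr_ge0 ?ltW// mulN1r opprK addr0.
by rewrite -(cvg_lim (@norm_hausdorff _ _) h) Ipm; exact: cvg_lim (cvg_cst _).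
Qed.

End laplace_uniqueness.

(** * Finite signed measures as normal functionals *)

Section normal_functionals.
Variables (R : realType) (k : nat).
Local Notation T := (k.-tuple (measurableTypeR R)).

(** The functional is integration against the image under [Phi] of the signed measure with density
    [rho]; dominated convergence, with bound C |rho|, gives the continuity. *)
Lemma normal_functional_integral d (Y : measurableType d)
    (m : {measure set Y -> \bar R}) (rho : Y -> R) (Phi : Y -> T) :
  m.-integrable setT (EFin \o rho) -> measurable_fun setT Phi ->
  (forall y, orthant (Phi y)) ->
  normal_functional (fun F : T -> R => \int[m]_y (rho y * F (Phi y))).
Proof.
move=> irho mPhi oPhi.
have mrho : measurable_fun setT rho by exact/measurable_EFinP/(measurable_int _ irho).
have mF F : measurable_fun setT F -> measurable_fun setT (fun y => rho y * F (Phi y) : R).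
  by move=> mF; apply: measurable_funM => //; exact: measurableT_comp mPhi.
have iF F : orthant_bounded F ->
    m.-integrable setT (EFin \o (fun y => rho y * F (Phi y))).
  move=> [mF' [C FC]].
  apply: (@le_integrable _ _ _ m _ measurableT _ (fun y => (C * rho y)%:E)).
  - by apply/measurable_EFinP; exact: mF.
  - move=> y _ /=; rewrite lee_fin !normrM mulrC.
    by rewrite ler_wpM2r// (le_trans (FC _ (oPhi y)))// ler_norm.
  - exact: (integrableZl measurableT C irho).
split.
- move=> a F G bF bG.
  under eq_Rintegral do rewrite mulrDr mulrCA.
  rewrite RintegralD//; last 2 first.
  + by apply: (integrableZl measurableT a (iF _ bF)).
  + exact: iF.
  by rewrite RintegralZl//; exact: iF.
- move=> F_ F C mF_ mF0 FC FF.
  apply: fine_cvg.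
  have [| | | | |_ _] := @dominated_convergence _ _ _ m _ measurableT
    (fun n y => (rho y * F_ n (Phi y))%:E) (fun y => (rho y * F (Phi y))%:E)
    (fun y => C%:E * `|(rho y)%:E|)%E.
  - by move=> n; apply/measurable_EFinP; exact: mF.
  - by apply/measurable_EFinP; exact: mF.
  - apply: aeW => y _; apply: cvg_EFin; first exact: nearW.
    by apply: cvgM; [exact: cvg_cst|exact: FF].
  - by apply: integrableZl => //; exact: (integrable_abse irho).
  - apply: aeW => y n _; rewrite -EFinM lee_fin normrM mulrC ler_wpM2r//.
    exact: FC.
  move=> h; rewrite fineK//; apply: integrable_fin_num => //; apply: iF.
  exact: orthant_bounded_cvg FC FF.
Qed.

Lemma normal_functional_lin a (I J : (T -> R) -> R) : normal_functional I ->
  normal_functional J -> normal_functional (fun F => a * I F + J F).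
Proof.
move=> [lI cI] [lJ cJ]; split.
  by move=> b F G bF bG; rewrite lI// lJ//; ring.
move=> F_ F C mF_ mF FC FF; apply: cvgD; last exact: cJ FC FF.
by apply: cvgM; [exact: cvg_cst|exact: cI FC FF].
Qed.

Lemma normal_functional_cst0 : normal_functional (fun _ : T -> R => 0 : R).
Proof.
by split=> [a F G _ _|F_ F C _ _ _ _]; [rewrite mulr0 addr0|exact: cvg_cst].
Qed.

Lemma normal_functional_sum (J : Type) (s : seq J) (c : J -> R) (I : J -> (T -> R) -> R) :
  (forall j, normal_functional (I j)) ->
  normal_functional (fun F => \sum_(j <- s) c j * I j F).
Proof.
move=> nI; elim: s => [|j s IH].
  by under eq_fun do rewrite big_nil; exact: normal_functional_cst0.
by under eq_fun do rewrite big_cons; exact: normal_functional_lin.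
Qed.

End normal_functionals.

(** * Product Lebesgue measure and Gaussian bounds *)

Section tuple_measure_theory.
Variable R : realType.
Local Notation mR := (measurableTypeR R).
Local Notation leb := (@lebesgue_measure R).

Lemma integral_tuple_measureS k (f : k.+1.-tuple mR -> \bar R) :
  measurable_fun setT f -> (forall x, 0 <= f x)%E ->
  (\int[tuple_measure leb k.+1]_t f t =
   \int[leb]_x \int[tuple_measure leb k]_t f (cons_pair (x, t)))%E.
Proof.
move=> mf f0.
rewrite /= (@ge0_integral_pushforward _ _ _ _ _ _ (@measurable_cons_pair _ mR k))//.
rewrite preimage_setT.
have mfc : measurable_fun setT (f \o @cons_pair _ mR k).
  by apply: measurableT_comp => //; exact: measurable_cons_pair.
rewrite (fubini_tonelli1 _ mfc); [by []|by move=> x; exact: f0].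
Qed.

Lemma measurable_tuple_map k (phi : nat -> mR -> mR) :
  (forall i, measurable_fun setT (phi i)) ->
  measurable_fun setT (fun t : k.-tuple mR => [tuple phi i (tnth t i) | i < k]).
Proof.
move=> mphi; apply/measurable_fun_tnthP => i.
rewrite (_ : _ \o _ = fun t => phi i (tnth t i)).
  by apply: measurableT_comp => //; exact: measurable_tnth.
by apply/funext => t /=; rewrite tnth_mktuple.
Qed.

(** Each coordinate undergoes its own measure-preserving map; Tonelli peels off the first one. The
    family [phi] is indexed by [nat] so that the induction can shift it. *)
Lemma integral_tuple_measure_map k (phi : nat -> mR -> mR) (f : k.-tuple mR -> \bar R) :
  (forall i, measurable_fun setT (phi i)) ->
  (forall i (g : mR -> \bar R), measurable_fun setT g -> (forall x, 0 <= g x)%E ->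
    (\int[leb]_x g (phi i x) = \int[leb]_x g x)%E) ->
  measurable_fun setT f -> (forall x, 0 <= f x)%E ->
  (\int[tuple_measure leb k]_t f [tuple phi i (tnth t i) | i < k] =
   \int[tuple_measure leb k]_t f t)%E.
Proof.
elim: k phi f => [|k IH] phi f mphi phiP mf f0.
  by apply: eq_integral => t _; congr f; apply: eq_from_tnth => -[].
rewrite !integral_tuple_measureS//; last first.
  by apply: measurableT_comp => //; exact: measurable_tuple_map.
pose g x := (\int[tuple_measure leb k]_t f (cons_pair (x, t)))%E.
have mfc : measurable_fun setT (f \o @cons_pair _ mR k).
  by apply: measurableT_comp => //; exact: measurable_cons_pair.
transitivity (\int[leb]_x g (phi 0%N x))%E; last first.
  apply: phiP => //.
    by apply: (measurable_fun_fubini_tonelli_F _ mfc) => x; exact: f0.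
  by move=> x; exact: integral_ge0.
apply: eq_integral => x _; rewrite /g.
rewrite -(IH (fun i => phi i.+1) (fun t => f (cons_pair (phi 0%N x, t))))//.
- apply: eq_integral => t _; congr f; apply: eq_from_tnth => i.
  rewrite tnth_mktuple; case: (unliftP ord0 i) => [j ->|->]; last by rewrite !tnth0.
  by rewrite !tnthS tnth_mktuple.
- by move=> i; exact: phiP.
- exact: (measurableT_comp mfc (pair1_measurable _)).
Qed.

(** The push-forward of Lebesgue measure under [phi] agrees with it on half-open intervals, hence
    everywhere by uniqueness. *)
Lemma integral_lebesgue_isometry (phi : mR -> mR) (g : mR -> \bar R) :
  measurable_fun setT phi ->
  (forall a b, leb (phi @^-1` `]a, b]) = leb `]a, b]) ->
  measurable_fun setT g -> (forall x, 0 <= g x)%E ->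
  (\int[leb]_x g (phi x) = \int[leb]_x g x)%E.
Proof.
move=> mphi phiP mg g0.
pose mphi_mixin := isMeasurableFun.Build _ _ _ _ _ mphi.
pose mphi_pack : {mfun _ >-> _} := HB.pack phi mphi_mixin.
transitivity (\int[pushforward leb phi]_x g x)%E.
  by rewrite ge0_integral_pushforward// preimage_setT.
apply: eq_measure_integral => A mA _.
apply/esym/(@lebesgue_measure_unique _ (pushforward leb mphi_pack)) => //.
by move=> _ [[a b]] _ <-; exact/esym/phiP.
Qed.

Lemma integral_lebesgue_reflection (c : R) (g : mR -> \bar R) :
  measurable_fun setT g -> (forall x, 0 <= g x)%E ->
  (\int[leb]_x g (c - x)%R = \int[leb]_x g x)%E.
Proof.
apply: integral_lebesgue_isometry.
  by apply: measurable_funB => //; exact: measurable_cst.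
move=> a b; have -> : (fun x => c - x) @^-1` `]a, b] = `[c - b, c - a[%classic.
  apply/seteqP; split => x /=; rewrite !in_itv/= ltrBrDl lerBlDl.
    by rewrite -ltrBrDr -lerBlDr addrC; case/andP => -> ->.
  by case/andP => h1 h2; apply/andP; split; lra.
rewrite !lebesgue_measure_itv/= !lte_fin -!EFinB.
rewrite (_ : (c - b < c - a) = (a < b)); last by lra.
by rewrite (_ : c - a - (c - b) = b - a)//; lra.
Qed.

Lemma integral_lebesgue_translation (c : R) (g : mR -> \bar R) :
  measurable_fun setT g -> (forall x, 0 <= g x)%E ->
  (\int[leb]_x g (x + c)%R = \int[leb]_x g x)%E.
Proof.
apply: integral_lebesgue_isometry.
  by apply: measurable_funD => //; exact: measurable_cst.
move=> a b; have -> : (fun x => x + c) @^-1` `]a, b] = `]a - c, b - c]%classic.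
  by apply/seteqP; split => x /=; rewrite !in_itv/= ltrBlDr lerBrDr.
rewrite !lebesgue_measure_itv/= !lte_fin -!EFinB ltrBlDr addrNK.
by rewrite (_ : b - c - (a - c) = b - a)//; lra.
Qed.

Lemma integral_gaussian_lty (e : R) : 0 < e ->
  (\int[leb]_x (expR (- (e * x ^+ 2)))%:E < +oo)%E.
Proof.
(* The variance 1 / (2 e) turns the normal density into a multiple of exp(-e x^2). *)
move=> e0; pose s : R := Num.sqrt (2 * e)^-1.
have s0 : s != 0 by rewrite gt_eqF// sqrtr_gt0 invr_gt0 mulr_gt0.
have s2 : s ^+ 2 *+ 2 = e^-1.
  rewrite sqr_sqrtr ?invr_ge0 ?mulr_ge0 ?ltW// -mulr_natr; field.
  by rewrite gt_eqF.
have := integrableZl measurableT (normal_peak s)^-1 (integrable_normal_pdf 0 s).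
move=> /integrable_lty h; apply: (le_lt_trans _ (h measurableT)).
rewrite le_eqVlt; apply/orP; left; apply/eqP/eq_integral => x _ /=.
rewrite -EFinM normal_pdfE// /normal_fun subr0 s2 invrK [in RHS]mulrA mulVf ?mul1r.
  by rewrite mulNr mulrC.
by rewrite gt_eqF// normal_peak_gt0.
Qed.

Lemma measurable_sum_sqr k (e : R) :
  measurable_fun setT (fun t : k.-tuple mR => expR (- (e * \sum_i tnth t i ^+ 2)) : R).
Proof.
apply: measurableT_comp; first exact: measurable_expR.
apply: measurable_funN; apply: measurable_funM => //.
apply: measurable_sum => i; apply: measurable_funX.
exact: (@measurable_tnth _ mR).
Qed.

Lemma integral_tuple_gaussian_lty k (e : R) : 0 < e ->
  (\int[tuple_measure leb k]_t (expR (- (e * \sum_i tnth t i ^+ 2)))%:E < +oo)%E.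
Proof.
move=> e0; elim: k => [|k IH].
  rewrite (@integral_dirac _ _ _ _ _ measurableT) ?diracT ?mul1e ?ltry//.
  by apply/measurable_EFinP; exact: measurable_sum_sqr.
rewrite integral_tuple_measureS//; last first.
  by apply/measurable_EFinP; exact: measurable_sum_sqr.
have inner x : (\int[tuple_measure leb k]_t
      (expR (- (e * \sum_i tnth (cons_pair (x, t)) i ^+ 2)))%:E =
    (expR (- (e * x ^+ 2)))%:E *
      \int[tuple_measure leb k]_t (expR (- (e * \sum_i tnth t i ^+ 2)))%:E)%E.
  have mG : measurable_fun setT (fun t : k.-tuple mR =>
      (expR (- (e * \sum_i tnth t i ^+ 2)))%:E).
    by apply/measurable_EFinP; exact: measurable_sum_sqr.
  rewrite -ge0_integralZl ?lee_fin ?expR_ge0//.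
  apply: eq_integral => t _; rewrite -EFinM -expRD -opprD -mulrDr.
  rewrite big_ord_recl tnth0; congr ((expR (- (_ * (_ + _))))%:E).
  by apply: eq_bigr => i _; rewrite tnthS.
under eq_integral do rewrite inner.
have mg : measurable_fun setT (fun x : mR => (expR (- (e * x ^+ 2)))%:E).
  apply/measurable_EFinP; apply: measurableT_comp; first exact: measurable_expR.
  by apply: measurable_funN; apply: measurable_funM => //; exact: measurable_funX.
rewrite ge0_integralZr//; last first.
  by apply: integral_ge0 => t _; rewrite lee_fin expR_ge0.
apply: lte_mul_pinfty => //.
- by apply: integral_ge0 => t _; rewrite lee_fin expR_ge0.
- rewrite ge0_fin_numE ?integral_gaussian_lty//.
  by apply: integral_ge0 => t _; rewrite lee_fin expR_ge0.
Qed.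

Lemma integrable_tuple_gaussian k (e C : R) (f : k.-tuple mR -> R) : 0 < e ->
  measurable_fun setT f ->
  (forall t, `|f t| <= C * expR (- (e * \sum_i tnth t i ^+ 2))) ->
  (tuple_measure leb k).-integrable setT (EFin \o f).
Proof.
move=> e0 mf fC.
apply: (@le_integrable _ _ _ (tuple_measure leb k) _ measurableT _
  (fun t : k.-tuple mR => (C * expR (- (e * \sum_i tnth t i ^+ 2)))%:E)).
- exact/measurable_EFinP.
- by move=> t _ /=; rewrite lee_fin (le_trans (fC t))// ler_norm.
have ig : (tuple_measure leb k).-integrable setT
    (EFin \o (fun t : k.-tuple mR => expR (- (e * \sum_i tnth t i ^+ 2)))).
  apply/integrableP; split; first by apply/measurable_EFinP; exact: measurable_sum_sqr.
  under eq_integral do rewrite /= ger0_norm ?expR_ge0//.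
  exact: integral_tuple_gaussian_lty.
exact: (integrableZl measurableT C ig).
Qed.

(** A zero integral would force f = 0 almost everywhere, making the whole space null. Its mass is
    nonzero by induction: 1 in dimension 0, then a nonzero mass times +oo. *)
Lemma integral_tuple_gt0 k (f : k.-tuple mR -> R) : measurable_fun setT f ->
  (forall t, 0 < f t) -> (0 < \int[tuple_measure leb k]_t (f t)%:E)%E.
Proof.
move=> mf f0.
rewrite lt_neqAle integral_ge0 ?andbT => [|t _]; last by rewrite lee_fin ltW.
apply/eqP => /esym I0.
have : ae_eq (tuple_measure leb k) setT (EFin \o f) (cst 0%E).
  apply/(ae_eq_integral_abs _ measurableT); first exact/measurable_EFinP.
  by rewrite -[RHS]I0; apply: eq_integral => t _ /=; rewrite gtr0_norm.
move=> [A [mA A0 subA]].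
suff : tuple_measure leb k setT != 0%E.
  move/eqP; apply; apply/eqP; rewrite eq_le measure_ge0 andbT -A0.
  rewrite le_measure ?inE// => t _; apply: subA => /= ft.
  by have [ft0] := ft Logic.I; have := f0 t; rewrite ft0 ltxx.
elim: (k) => [|j IH]; first by rewrite /= diracT onee_neq0.
have <- : (\int[tuple_measure leb j.+1]_t 1)%E = tuple_measure leb j.+1 setT.
  by rewrite integral_cst// mul1e.
rewrite integral_tuple_measureS//.
under eq_integral do rewrite integral_cst// mul1e.
rewrite integral_cst//; apply: mule_neq0; first exact: IH.
have leboo : @lebesgue_measure R setT = +oo%E.
  by rewrite -(set_itvNyy R) lebesgue_measure_itv.
by move: leboo => /= ->.
Qed.

Lemma exp_dominates_poly (q : nat) (d : R) : 0 < d ->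
  exists C : R, forall y, 0 <= y -> (1 + y) ^+ q <= C * expR (d * y).
Proof.
(* This c gives 1 + y <= c (1 + d y / (q+1)) <= c exp(d y / (q+1)), whose q-th power is at most c^q
   exp(d y). Dividing by q + 1 instead of q covers q = 0. *)
move=> d0; pose c := d^-1 * q.+1%:R + 1.
have c0 : 0 < c by rewrite ltr_wpDl// mulr_ge0// invr_ge0 ltW.
exists (c ^+ q) => y y0.
have : 1 + y <= c * expR (d * y / q.+1%:R).
  apply: le_trans (_ : c * (1 + d * y / q.+1%:R) <= _); last first.
    by rewrite ler_wpM2l ?expR_ge1Dx// ltW.
  have -> : c * (1 + d * y / q.+1%:R) = c + y + d * y / q.+1%:R.
    by rewrite /c; field; rewrite addrC natr1 pnatr_eq0/= gt_eqF.
  have h1 : 1 <= c by rewrite lerDr mulr_ge0// invr_ge0 ltW.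
  have h2 : 0 <= d * y / q.+1%:R by rewrite mulr_ge0// mulr_ge0// ltW.
  by rewrite -[leLHS]addr0 lerD// lerD2r.
move=> h; apply: le_trans (_ : (c * expR (d * y / q.+1%:R)) ^+ q <= _).
  by rewrite lerXn2r// nnegrE ?addr_ge0// mulr_ge0 ?expR_ge0// ltW.
rewrite exprMn ler_wpM2l ?exprn_ge0 ?(ltW c0)// -expRM_natl ler_expR mulrA.
rewrite ler_pdivrMr// mulrC ler_wpM2l ?mulr_ge0 ?(ltW d0)// ler_nat//.
Qed.

End tuple_measure_theory.

(** * Occupation times of a right-continuous path *)

Section real_integrals.
Context d (T : measurableType d) (R : realType).

Lemma Rintegral_sum (m : {measure set T -> \bar R}) (I : Type) (s : seq I)
    (f : I -> T -> R) : (forall i, m.-integrable setT (EFin \o f i)) ->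
  \int[m]_x (\sum_(i <- s) f i x) = \sum_(i <- s) \int[m]_x f i x.
Proof.
move=> fi; elim: s => [|i s IH].
  by under eq_Rintegral do rewrite big_nil; rewrite Rintegral_cst// mul0r big_nil.
under eq_Rintegral do rewrite big_cons.
rewrite RintegralD// ?IH ?big_cons//.
have := integrable_sum measurableT s (P := xpredT) (fun i _ => fi i).
by apply: eq_integrable => // x _ /=; rewrite sumEFin.
Qed.

Lemma Rintegral_dominated_cvg (m : {measure set T -> \bar R}) (D : set T)
    (f_ : nat -> T -> R) (f g : T -> R) : measurable D ->
  (forall n, measurable_fun D (f_ n)) -> measurable_fun D f ->
  {ae m, forall x, D x -> f_ ^~ x @ \oo --> f x} ->
  m.-integrable D (EFin \o g) ->
  (forall n x, D x -> `|f_ n x| <= g x) ->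
  m.-integrable D (EFin \o f) /\
  \int[m]_(x in D) f_ n x @[n --> \oo] --> \int[m]_(x in D) f x.
Proof.
move=> mD mf_ mf ff ig fg.
have [| | | | |intf _ h] := @dominated_convergence _ _ _ m _ mD
  (fun n x => (f_ n x)%:E) (EFin \o f) (EFin \o g).
- by move=> n; exact/measurable_EFinP.
- exact/measurable_EFinP.
- by apply: filterS ff => x h Dx; apply: cvg_EFin; [exact: nearW|exact: h].
- by [].
- by apply: aeW => x n Dx; rewrite lee_fin fg.
split => //; apply: fine_cvg; rewrite fineK//.
exact: integrable_fin_num.
Qed.

Lemma probability_bounded_integrable (P : probability T R) (f : T -> R) (C : R) :
  measurable_fun setT f -> (forall x, `|f x| <= C) ->
  P.-integrable setT (EFin \o f).
Proof.
move=> mf fC; apply: (@le_integrable _ _ _ P _ measurableT _ (EFin \o cst C)).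
- exact/measurable_EFinP.
- by move=> x _ /=; rewrite lee_fin (le_trans (fC x))// ler_norm.
- exact: finite_measure_integrable_cst.
Qed.

End real_integrals.

Section walk.
Context (R : realType) (Lam : finType) d (Om : measurableType d).
Local Notation mR := (measurableTypeR R).
Local Notation leb := (@lebesgue_measure R).
Variable X : R -> Om -> Lam.
Hypothesis mX : forall t i, measurable [set w | X t w = i].
Hypothesis rcX : forall w t, \forall r \near t^'+, X r w = X t w.

Lemma measurable_state (f : Lam -> R) t : measurable_fun setT (fun w => f (X t w)).
Proof.
have -> : (fun w => f (X t w)) =
    (fun w => \sum_(i <- index_enum Lam) f i * \1_[set w | X t w = i] w).
  apply/funext => w; rewrite (bigD1 (X t w))//= indicE mem_set// mulr1.
  rewrite big1 ?addr0// => j jX; rewrite indicE memNset ?mulr0//=.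
  by apply/eqP; rewrite eq_sym.
by apply: measurable_sum => i; apply: measurable_funM => //; exact: measurable_indic.
Qed.

Lemma right_continuous_ex w t : exists2 e : R, 0 < e &
  forall r, t <= r < t + e -> X r w = X t w.
Proof.
have /nbhs_ballP[e /= e0 h] := rcX w t.
exists e => // r /andP[]; rewrite le_eqVlt => /predU1P[->//|tr re].
apply: (h r) => //=; rewrite /ball/= ltr0_norm ?subr_lt0//.
by rewrite opprB ltrBlDl.
Qed.

(* X(r) is the limit of X evaluated at the first point of the lattice
   (1/m) Z strictly after r. *)
Lemma measurable_state_pair (f : Lam -> R) :
  measurable_fun setT (fun z : mR * Om => f (X z.1 z.2)).
Proof.
suff h i : measurable_fun setT (fun z : mR * Om => (X z.1 z.2 == i)%:R : R).
  have -> : (fun z : mR * Om => f (X z.1 z.2)) =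
      (fun z => \sum_(i <- index_enum Lam) f i * (X z.1 z.2 == i)%:R).
    apply/funext => z; rewrite (bigD1 (X z.1 z.2))//= eqxx mulr1.
    by rewrite big1 ?addr0// => j jX; rewrite eq_sym (negbTE jX) mulr0.
  by apply: measurable_sum => j; exact: measurable_funM.
pose cell m (z : int) : set mR := [set r | z%:~R <= r * m.+1%:R < (z + 1)%:~R].
pose B m := \bigcup_(z : int) (cell m z `*` [set w | X ((z + 1)%:~R / m.+1%:R) w = i]).
have mB m : measurable (B m).
  apply: countable_bigcupT_measurable => // z; apply: measurableX => //.
  rewrite /cell (_ : [set r | _] = `[z%:~R / m.+1%:R, (z + 1)%:~R / m.+1%:R[%classic)//.
  by apply/seteqP; split => r /=; rewrite in_itv/= ler_pdivrMr// ltr_pdivlMr.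
apply: (@measurable_fun_cvg _ _ _ _ (fun m => \1_(B m) : _ -> R)).
  by move=> m; exact: measurable_indic.
move=> [r w] _ /=.
have BE m : \1_(B m) (r, w) =
    (X ((Num.floor (r * m.+1%:R) + 1)%:~R / m.+1%:R) w == i)%:R :> R.
  rewrite indicE; congr (nat_of_bool _)%:R; apply/idP/eqP; rewrite inE.
    by move=> [z _ [/= /floor_def -> ]].
  by move=> Xi; exists (Num.floor (r * m.+1%:R)) => //; split => //=; exact: floor_itv.
apply: cvg_near_cst.
have [e e0 he] := right_continuous_ex w r.
near=> m; rewrite BE he//.
have /andP[f1 f2] := floor_itv (r * m.+1%:R).
rewrite ler_pdivlMr// (ltW f2)/= ltr_pdivrMr// mulrDl intrD ler_ltD//.
rewrite -ltr_pdivrMr// mul1r.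
near: m; exact: (near_infty_natSinv_lt (PosNum e0)).
Unshelve. all: by end_near. Qed.

(** The additive functional of the walk with rate [kappa]. Indicators of sites give the increments
    of the local times, and [occupation_sum] recovers every other rate from these. *)
Definition occupation (kappa : Lam -> R) (a b : R) (w : Om) : R :=
  \int[leb]_(r in `[a, b]) kappa (X r w).

Lemma measurable_state_path (kappa : Lam -> R) w D :
  measurable_fun D (fun r : mR => kappa (X r w)).
Proof.
apply: measurable_funTS.
exact: (measurableT_comp (measurable_state_pair kappa) (pair2_measurable w)).
Qed.

Lemma integrable_state_path (kappa : Lam -> R) a b w :
  leb.-integrable `[a, b] (EFin \o (fun r => kappa (X r w))).
Proof.
apply: measurable_bounded_integrable => //.
- by rewrite /= lebesgue_measure_itv/=; case: ifP => _; rewrite -?EFinB ltry.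
- exact: measurable_state_path.
exists (\sum_i `|kappa i|); split; first by rewrite num_real.
move=> x xs r _ /=; apply: le_trans (ltW xs).
by rewrite (bigD1 (X r w))//= lerDl sumr_ge0.
Qed.

Lemma occupation_split kappa a b c w : a <= b -> b <= c ->
  occupation kappa a c w = occupation kappa a b w + occupation kappa b c w.
Proof.
move=> ab bc; apply/eqP; rewrite addrC -subr_eq; apply/eqP.
rewrite /occupation -[in RHS](@Rintegral_itv_obnd_cbnd _ _ _ (fun r => kappa (X r w))); last first.
  by apply: integrableS (integrable_state_path kappa b c w) => //; exact: subset_itv_oc_cc.
apply: Rintegral_itvB; rewrite ?bnd_simp//.
exact: integrable_state_path.
Qed.

Lemma occupation_lin (a : R) (f g : Lam -> R) t0 t1 w :
  occupation (fun i => a * f i + g i) t0 t1 w =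
  a * occupation f t0 t1 w + occupation g t0 t1 w.
Proof.
rewrite /occupation RintegralD//; last 2 first.
- exact: (integrable_state_path (fun i => a * f i)).
- exact: integrable_state_path.
by rewrite RintegralZl//; exact: integrable_state_path.
Qed.

Lemma occupation_sum (kappa : Lam -> R) a b w :
  occupation kappa a b w =
  \sum_j kappa j * occupation (fun i => (i == j)%:R) a b w.
Proof.
transitivity (occupation (fun i => \sum_(j <- index_enum Lam) kappa j * (i == j)%:R) a b w).
  apply: eq_Rintegral => r _; rewrite (bigD1 (X r w))//= eqxx mulr1.
  by rewrite big1 ?addr0// => j jX; rewrite eq_sym (negbTE jX) mulr0.
elim: (index_enum Lam) => [|j s IH].
  rewrite big_nil -[RHS](mul0r (occupation (fun=> 0) a b w)).
  transitivity (occupation (fun i => 0 * 0 + 0) a b w).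
    by apply: eq_Rintegral => r _; rewrite big_nil mul0r addr0.
  rewrite (occupation_lin 0 (fun=> 0) (fun=> 0)) !mul0r add0r.
  by rewrite /occupation Rintegral_cst// mul0r.
rewrite big_cons -IH -occupation_lin.
by apply: eq_Rintegral => r _; rewrite big_cons.
Qed.

Lemma occupation_cst (c : R) a b w : a <= b -> occupation (fun=> c) a b w = c * (b - a).
Proof.
move=> ab; rewrite /occupation Rintegral_cst//= lebesgue_measure_itv/= lte_fin.
by case: ltP => // ba; rewrite (@le_anti _ _ a b) ?ab// subrr.
Qed.

Lemma le_occupation (f g : Lam -> R) a b w : (forall i, f i <= g i) ->
  occupation f a b w <= occupation g a b w.
Proof. by move=> fg; apply: le_Rintegral => //; exact: integrable_state_path. Qed.

Lemma occupation_ge0 (f : Lam -> R) a b w : (forall i, 0 <= f i) ->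
  0 <= occupation f a b w.
Proof. by move=> f0; exact: Rintegral_ge0. Qed.

(** Measurability holds jointly in time and path: the moving upper limit is turned into an indicator
    in the integrand, so that Tonelli applies over the fixed domain of all real r. *)
Lemma measurable_occupation (kappa : Lam -> R) :
  measurable_fun setT (fun z : mR * Om => occupation kappa 0 z.1 z.2).
Proof.
suff h i : measurable_fun setT
    (fun z : mR * Om => occupation (fun j => (j == i)%:R) 0 z.1 z.2).
  under eq_fun do rewrite occupation_sum.
  by apply: measurable_sum => i; exact: measurable_funM.
pose g (y : (mR * Om) * mR) : \bar R :=
  ((0 <= y.2 <= y.1.1)%R%:R * (X y.2 y.1.2 == i)%:R)%:E.
have mg : measurable_fun setT g.
  apply/measurable_EFinP; apply: measurable_funM.
    rewrite (_ : (fun _ => _) = \1_([set y : (mR * Om) * mR | 0 <= y.2] `&`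
       [set y : (mR * Om) * mR | y.2 <= y.1.1])).
      apply: measurable_indic; apply: measurableI.
        rewrite -[X in measurable X]setTI; apply: measurable_fun_ler => //.
      rewrite -[X in measurable X]setTI; apply: measurable_fun_ler => //.
      exact: measurableT_comp.
    apply/funext => y; rewrite indicE; congr (nat_of_bool _)%:R.
    apply/idP/idP; rewrite inE/= => /andP//.
  have h : measurable_fun setT (fun y : (mR * Om) * mR => (y.2, y.1.2)).
    by apply: measurable_fun_pair => //; exact: measurableT_comp.
  exact: (measurableT_comp (measurable_state_pair (fun j => (j == i)%:R)) h).
have := measurable_fun_fubini_tonelli_F (m2 := leb) g mg.
move=> /(_ (fun y => _)) mF.
apply: (eq_measurable_fun (fun z => fine (fubini_F leb g z))).
  move=> [t w] _; rewrite /occupation /Rintegral; congr fine.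
  rewrite [RHS]integral_mkcond; apply: eq_integral => r _.
  rewrite /g /patch/= mem_setE in_itv/=; case: ifP => _; rewrite ?mul1r ?mul0r//.
apply: measurableT_comp; first exact: fine_measurable.
by apply: mF => y; rewrite lee_fin mulr_ge0.
Qed.

End walk.

(** * Riemann sums for occupation times *)

Section riemann.
Context (R : realType) (Lam : finType) d (Om : measurableType d).
Local Notation mR := (measurableTypeR R).
Local Notation leb := (@lebesgue_measure R).
Variable X : R -> Om -> Lam.
Hypothesis mX : forall t i, measurable [set w | X t w = i].
Hypothesis rcX : forall w t, \forall r \near t^'+, X r w = X t w.

Let occupation_set1 kappa a w : occupation X kappa a a w = 0.
Proof.
have := occupation_split mX rcX kappa w (lexx a) (lexx a) => /eqP.
by rewrite -subr_eq subrr eq_sym => /eqP.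
Qed.

(** The sum is the integral of the step function equal, at r, to the rate at the right endpoint of
    the cell of r. That endpoint lies strictly after r and tends to r, so right-continuity gives
    convergence at every r, jump times included. The point of such sums is that their exponentials
    depend on finitely many states only. *)
Lemma riemann_occupation_cvg (kappa : Lam -> R) a t w : 0 <= t ->
  \sum_(m < N.+1) kappa (X (a + m.+1%:R * (t / N.+1%:R)) w) * (t / N.+1%:R)
    @[N --> \oo] --> occupation X kappa a (a + t) w.
Proof.
rewrite le_eqVlt => /predU1P[<-|t0].
  rewrite addr0 occupation_set1.
  rewrite [X in X @ _ --> _](_ : _ = fun=> 0); first exact: cvg_cst.
  by apply/funext => N; rewrite big1// => i _; rewrite mul0r !mulr0.
pose dl N : R := t / N.+1%:R.
have dl0 N : 0 < dl N by rewrite divr_gt0.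
pose cell N m : set mR := `[a + m%:R * dl N, a + m.+1%:R * dl N[%classic.
pose f_ N r := \sum_(m < N.+1) kappa (X (a + m.+1%:R * dl N) w) * \1_(cell N m) r.
pose f r := kappa (X r w) * \1_(`[a, a + t[%classic) r.
pose K := \sum_i `|kappa i|.
have kK i : `|kappa i| <= K by rewrite /K (bigD1 i)//= lerDl sumr_ge0.
have mcell N m : measurable (cell N m) by exact: measurable_itv.
have icell N m : leb.-integrable setT (EFin \o \1_(cell N m)).
  exact: (integrable_indic_itv (a + m%:R * dl N) (a + m.+1%:R * dl N) true true).
have cellE N m r : a <= r ->
    (r \in cell N m) = (Num.truncn ((r - a) / dl N) == m).
  move=> ar; have x0 : 0 <= (r - a) / dl N.
    by rewrite divr_ge0 ?subr_ge0//; exact/ltW/dl0.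
  rewrite truncn_eq// ler_pdivlMr// ltr_pdivrMr// lerBrDl ltrBlDl.
  by rewrite mem_setE in_itv.
have f_in N r : a <= r < a + t ->
    f_ N r = kappa (X (a + (Num.truncn ((r - a) / dl N)).+1%:R * dl N) w).
  move=> /andP[ar rt]; set M := Num.truncn _.
  have MN : (M < N.+1)%N.
    rewrite -(ltr_nat R); apply: le_lt_trans (_ : (r - a) / dl N < _).
      by rewrite truncn_le// divr_ge0 ?subr_ge0//; exact/ltW/dl0.
    rewrite ltr_pdivrMr// ltrBlDl /dl mulrCA divff ?mulr1//.
  rewrite /f_ (bigD1 (Ordinal MN))//= indicE cellE// eqxx mulr1.
  rewrite big1 ?addr0// => m /negbTE mM; rewrite indicE cellE//.
  by rewrite (_ : _ == _ = false) ?mulr0// eq_sym -mM.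
have f_out N r : ~~ (a <= r < a + t) -> f_ N r = 0.
  move=> h; rewrite /f_ big1// => m _; rewrite indicE memNset ?mulr0// /cell/= in_itv/=.
  move=> /andP[h1 h2]; move/negP : h; apply; apply/andP; split.
    by rewrite (le_trans _ h1)// lerDl mulr_ge0// ltW.
  rewrite (lt_le_trans h2)// lerD2l /dl mulrCA ler_piMr ?(ltW t0)//.
  by rewrite ler_pdivrMr// mul1r ler_nat.
have f_K N r : `|f_ N r| <= K * \1_(`[a, a + t[%classic) r.
  rewrite indicE mem_setE in_itv/=; have [h|h] := boolP (a <= r < a + t).
    by rewrite mulr1 f_in.
  by rewrite f_out// normr0 mulr0.
have ff r : f_ ^~ r @ \oo --> f r.
  apply: cvg_near_cst; rewrite /f indicE mem_setE in_itv/=.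
  have [h|h] := boolP (a <= r < a + t); last first.
    by apply: nearW => N; rewrite f_out ?mulr0.
  have /andP[ar rt] := h.
  have [e e0 he] := right_continuous_ex rcX w r.
  near=> N; rewrite mulr1 f_in// he//.
  have x0 : 0 <= (r - a) / dl N.
    by rewrite divr_ge0 ?subr_ge0//; exact/ltW/dl0.
  have /andP[] := truncn_itv x0.
  rewrite ler_pdivlMr// ltr_pdivrMr// => h1 h2.
  rewrite -lerBlDl (ltW h2)/= -natr1 mulrDl mul1r addrA.
  rewrite (@le_lt_trans _ _ (r + dl N))// ?lerD2r -?lerBrDl// ltrD2l.
  rewrite /dl -ltr_pdivlMl// mulrC.
  near: N; exact: (near_infty_natSinv_lt (PosNum (divr_gt0 e0 t0))).
have mf_ N : measurable_fun setT (f_ N).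
  by apply: measurable_sum => m; apply: measurable_funM => //; exact: measurable_indic.
have mf : measurable_fun setT f.
  by apply: (@measurable_fun_cvg _ _ _ _ f_) => // r _; exact: ff.
have ig : leb.-integrable setT (EFin \o (fun r => K * \1_(`[a, a + t[%classic) r)).
  exact: (integrableZl measurableT K (integrable_indic_itv a (a + t) true true)).
have [] := @Rintegral_dominated_cvg _ _ _ leb setT f_ f
  (fun r => K * \1_(`[a, a + t[%classic) r) measurableT mf_ mf _ ig _.
- by apply: aeW => r _; exact: ff.
- by move=> N r _; exact: f_K.
move=> _ h.
rewrite (_ : occupation X kappa a (a + t) w = \int[leb]_r f r).
- rewrite [X in X @ _ --> _](_ : _ = fun N => \int[leb]_r f_ N r)//.
  apply/funext => N; rewrite /f_ Rintegral_sum//; last first.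
    by move=> m; exact: (integrableZl measurableT _ (icell N m)).
  apply: eq_bigr => m _; rewrite RintegralZl//; congr (_ * _).
  rewrite /Rintegral integral_indic// setIT /cell.
  rewrite /= lebesgue_measure_itv/= lte_fin ltrD2l ltr_pM2r// ltr_nat ltnSn.
  by rewrite -EFinB/= -natr1 /dl; field; rewrite addrC natr1 pnatr_eq0.
- rewrite /occupation -Rintegral_itv_bndo_bndc; last first.
    apply: integrableS (integrable_state_path mX rcX kappa a (a + t) w) => //.
    exact: subset_itv_co_cc.
  rewrite [LHS]Rintegral_mkcond; apply: eq_Rintegral => r _.
  by rewrite /f /patch indicE; case: ifP => _; rewrite ?mulr1 ?mulr0.
Unshelve. all: by end_near. Qed.

End riemann.

(** * The Markov property *)

Section finite_dimensional.
Context (R : realType) (Lam : finType) d (Om : measurableType d).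
Variable X : R -> Om -> Lam.
Hypothesis mX : forall t i, measurable [set w | X t w = i].
Variables (P : Lam -> probability Om R) (p : R -> Lam -> Lam -> R).
Hypothesis markovX : forall i (s : seq (R * Lam)), path <=%R 0 (unzip1 s) ->
  P i [set w | forall q, q \in s -> X q.1 w = q.2] = (path_prob p 0 i s)%:E.

Lemma path_prob_rcons r i s t j : path_prob p r i (rcons s (t, j)) =
  path_prob p r i s * p (t - last r (unzip1 s)) (last i (unzip2 s)) j.
Proof.
elim: s r i => [|[t' j'] s IH] r i /=; first by rewrite mulr1 mul1r.
by rewrite IH mulrA.
Qed.

(** The finite-dimensional laws in integrated form: the iterated sum for the expectation of a
    product of functions of the states at successive times. *)
Fixpoint path_expectation (r : R) (x : Lam) (fs : seq (R * (Lam -> R))) : R :=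
  if fs is (t, f) :: fs' then
    \sum_j p (t - r) x j * (f j * path_expectation t j fs') else 1.

Let indic_path (s : seq (R * Lam)) : Om -> R := \1_[set w | forall q, q \in s -> X q.1 w = q.2].

Let measurable_path (s : seq (R * Lam)) :
  measurable [set w | forall q, q \in s -> X q.1 w = q.2].
Proof.
elim: s => [|q s IH].
  by rewrite (_ : [set w | _] = setT)//; apply/seteqP; split.
rewrite (_ : [set w | _] = [set w | X q.1 w = q.2] `&`
    [set w | forall q, q \in s -> X q.1 w = q.2]); first exact: measurableI.
apply/seteqP; split => w /=.
  by move=> h; split => [|q' q's]; apply: h; rewrite inE ?eqxx ?q's ?orbT.
by move=> [h1 h2] q'; rewrite inE => /predU1P[->//|/h2].
Qed.

Lemma measurable_prod_state (fs : seq (R * (Lam -> R))) :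
  measurable_fun setT (fun w => \prod_(q <- fs) q.2 (X q.1 w) : R).
Proof.
elim: fs => [|q fs IH]; first by under eq_fun do rewrite big_nil; exact: measurable_cst.
under eq_fun do rewrite big_cons.
by apply: measurable_funM => //; exact: measurable_state.
Qed.

Lemma bounded_prod_state (fs : seq (R * (Lam -> R))) :
  exists2 C : R, 0 <= C & forall w, `|\prod_(q <- fs) q.2 (X q.1 w)| <= C.
Proof.
elim: fs => [|q fs [C C0 IH]].
  by exists 1 => // w; rewrite big_nil normr1.
exists ((\sum_i `|q.2 i|) * C); first by rewrite mulr_ge0// sumr_ge0.
move=> w; rewrite big_cons normrM ler_pM//.
by rewrite (bigD1 (X q.1 w))//= lerDl sumr_ge0.
Qed.

(** The prefix [s] of prescribed states carries the induction: the first function of [fs] is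
    expanded over the values j of the state at its time t, and (t, j) is appended to [s]. *)
Let path_expectationE_gen i fs s :
  path <=%R 0 (unzip1 s ++ unzip1 fs) ->
  \int[P i]_w (indic_path s w * \prod_(q <- fs) q.2 (X q.1 w)) =
  path_prob p 0 i s * path_expectation (last 0 (unzip1 s)) (last i (unzip2 s)) fs.
Proof.
elim: fs s => [|[t f] fs IH] s /=.
  rewrite cats0 => h; under eq_Rintegral do rewrite big_nil mulr1.
  rewrite /Rintegral integral_indic// setIT mulr1.
  exact: (congr1 fine (markovX i h)).
move=> h.
have e j w : indic_path (rcons s (t, j)) w = indic_path s w * (X t w == j)%:R.
  rewrite /indic_path !indicE -natrM mulnb; congr (nat_of_bool _)%:R.
  apply/idP/andP; rewrite !inE.
    move=> h'; split; first by move=> q qs; apply: h'; rewrite mem_rcons inE qs orbT.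
    by apply/eqP; apply: (h' (t, j)); rewrite mem_rcons inE eqxx.
  by move=> -[h' /eqP Xj] q; rewrite mem_rcons inE => /predU1P[->//|/h'].
transitivity (\int[P i]_w (\sum_(j <- index_enum Lam)
    f j * (indic_path (rcons s (t, j)) w * \prod_(q <- fs) q.2 (X q.1 w)))).
  apply: eq_Rintegral => w _; rewrite big_cons/= (bigD1 (X t w))//= e eqxx mulr1.
  rewrite [X in _ = _ + X]big1 ?addr0; first by rewrite mulrCA.
  by move=> j jX; rewrite e eq_sym (negbTE jX) mulr0 mul0r mulr0.
have [C C0 bfs] := bounded_prod_state fs.
have ij j : (P i).-integrable setT (EFin \o
    (fun w => indic_path (rcons s (t, j)) w * \prod_(q <- fs) q.2 (X q.1 w))).
  apply: (@probability_bounded_integrable _ _ _ _ _ C).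
    by apply: measurable_funM; [exact: measurable_indic|exact: measurable_prod_state].
  move=> w; rewrite normrM (le_trans _ (bfs w))// ler_piMl//.
  by rewrite /indic_path indicE; case: (_ \in _); rewrite /= ?normr1 ?normr0.
rewrite Rintegral_sum; last by move=> j; exact: (integrableZl measurableT (f j) (ij j)).
rewrite mulr_sumr; apply: eq_bigr => j _.
rewrite RintegralZl// IH; last first.
  by rewrite /unzip1 map_rcons -/(unzip1 s)/= cat_rcons.
rewrite path_prob_rcons /unzip1 /unzip2 !map_rcons !last_rcons/=.
by rewrite mulrA [f j * _]mulrC -!mulrA.
Qed.

Lemma path_expectationE i fs : path <=%R 0 (unzip1 fs) ->
  \int[P i]_w (\prod_(q <- fs) q.2 (X q.1 w)) = path_expectation 0 i fs.
Proof.
move=> h; rewrite -[RHS]mul1r -(@path_expectationE_gen i fs [::])//.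
apply: eq_Rintegral => w _; rewrite /indic_path indicE mem_set ?mul1r//.
Qed.

Let delta_fun (j : Lam) : Lam -> R := fun x => (x == j)%:R.

Let path_expectation_cat r x fs1 t j fs2 :
  path_expectation r x (fs1 ++ (t, delta_fun j) :: fs2) =
  path_expectation r x (rcons fs1 (t, delta_fun j)) * path_expectation t j fs2.
Proof.
elim: fs1 r x => [|[t' f] fs1 IH] r x /=.
  rewrite mulr_suml; apply: eq_bigr => l _; rewrite mulr1 /delta_fun.
  by case: eqVneq => [->|_]; rewrite ?mul1r ?mulr1// !mul0r !mulr0 mul0r.
by rewrite mulr_suml; apply: eq_bigr => l _; rewrite IH !mulrA.
Qed.

Let path_expectation_shift c r x fs :
  path_expectation (c + r) x [seq (c + q.1, q.2) | q <- fs] = path_expectation r x fs.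
Proof.
elim: fs r x => [//|[t f] fs IH] r x /=.
by apply: eq_bigr => j _; rewrite IH opprD addrACA subrr add0r.
Qed.

(** The factor fixing the state j at time t collapses the sum over states there, so the iterated sum
    factors. The second factor depends only on time differences and is shifted back to start at
    0. *)
Lemma markov_property i t j fs1 fs2 :
  path <=%R 0 (rcons (unzip1 fs1) t) -> path <=%R 0 (unzip1 fs2) ->
  \int[P i]_w ((\prod_(q <- fs1) q.2 (X q.1 w)) * (X t w == j)%:R *
     \prod_(q <- fs2) q.2 (X (t + q.1) w)) =
  (\int[P i]_w ((\prod_(q <- fs1) q.2 (X q.1 w)) * (X t w == j)%:R)) *
  \int[P j]_w (\prod_(q <- fs2) q.2 (X q.1 w)).
Proof.
move=> h1 h2.
pose sh := [seq (t + q.1, q.2) | q <- fs2].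
have u1 : unzip1 (rcons fs1 (t, delta_fun j)) = rcons (unzip1 fs1) t.
  by rewrite /unzip1 map_rcons.
rewrite (path_expectationE j h2).
transitivity (path_expectation 0 i (fs1 ++ (t, delta_fun j) :: sh)).
  rewrite -path_expectationE; last first.
    rewrite /unzip1 map_cat/= -cat_rcons cat_path h1/= last_rcons.
    rewrite -/(unzip1 _) (_ : unzip1 sh = [seq t + x | x <- unzip1 fs2]); last first.
      by rewrite /unzip1 -!map_comp.
    rewrite -[X in path _ X _]addr0 path_map.
    by rewrite (eq_path (e' := <=%R)) // => x y /=; rewrite lerD2l.
  apply: eq_Rintegral => w _; rewrite big_cat big_cons/= mulrA; congr (_ * _).
  by rewrite /sh big_map.
rewrite path_expectation_cat -[in path_expectation t j sh](addr0 t) path_expectation_shift.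
congr (_ * _); rewrite -path_expectationE ?u1//.
by apply: eq_Rintegral => w _; rewrite big_rcons/= mulrC.
Qed.

Lemma markov_one i j t : 0 <= t -> \int[P i]_w (X t w == j)%:R = p t i j.
Proof.
move=> t0; have := @path_expectationE i [:: (t, delta_fun j)].
rewrite /= t0 => /(_ isT); under eq_Rintegral do rewrite big_seq1/=.
move=> ->; rewrite subr0 (bigD1 j)//= /delta_fun eqxx !mulr1 big1 ?addr0//.
by move=> l /negbTE lj; rewrite lj mul0r mulr0.
Qed.

End finite_dimensional.

(** * The killed semigroup and its resolvent *)

Lemma cvgr_sum (R : realType) (T I : Type) (F : set_system T) {FF : Filter F}
    (r : seq I) (Q : pred I) (f : I -> T -> R) (l : I -> R) :
  (forall i, Q i -> f i x @[x --> F] --> l i) ->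
  \sum_(i <- r | Q i) f i x @[x --> F] --> \sum_(i <- r | Q i) l i.
Proof.
move=> fl; elim: r => [|i r IH].
  by under eq_fun do rewrite big_nil; rewrite big_nil; exact: cvg_cst.
under eq_fun do rewrite big_cons; rewrite big_cons.
by case: ifPn => // Qi; apply: cvgD => //; exact: fl.
Qed.

Section feynman_kac.
Context (R : realType) (Lam : finType) d (Om : measurableType d).
Local Notation mR := (measurableTypeR R).
Local Notation leb := (@lebesgue_measure R).
Variable X : R -> Om -> Lam.
Hypothesis mX : forall t i, measurable [set w | X t w = i].
Hypothesis rcX : forall w t, \forall r \near t^'+, X r w = X t w.
Variables (P : Lam -> probability Om R) (p : R -> Lam -> Lam -> R).
Variable beta : Lam -> Lam -> R.
Hypothesis tp : transition_function beta p.
Hypothesis markovX : forall i (s : seq (R * Lam)), path <=%R 0 (unzip1 s) ->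
  P i [set w | forall q, q \in s -> X q.1 w = q.2] = (path_prob p 0 i s)%:E.
Variable kappa : Lam -> R.
Hypothesis kappa_ge1 : forall i, 1 <= kappa i.

Let kappa_ge0 i : 0 <= kappa i. Proof. exact: le_trans (kappa_ge1 i). Qed.

(** The Feynman-Kac functional of the killing rate [kappa], which is later taken to be h + K. *)
Definition survival t a (w : Om) : R :=
  expR (- occupation X kappa 0 t w) * (X t w == a)%:R.

Definition killed_semigroup t i a : R := \int[P i]_w survival t a w.

Local Notation psi := killed_semigroup.

Lemma measurable_survival_pair a :
  measurable_fun setT (fun z : mR * Om => survival z.1 a z.2).
Proof.
apply: measurable_funM.
  apply: measurableT_comp; first exact: measurable_expR.
  by apply: measurable_funN; exact: measurable_occupation.
exact: (measurable_state_pair mX rcX (fun j => (j == a)%:R)).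
Qed.

Let measurable_occ t : measurable_fun setT (fun w => occupation X kappa 0 t w).
Proof. exact: (measurableT_comp (measurable_occupation mX rcX kappa) (pair1_measurable t)). Qed.

Lemma measurable_survival t a : measurable_fun setT (survival t a).
Proof. exact: (measurableT_comp (measurable_survival_pair a) (pair1_measurable t)). Qed.

Lemma survival_ge0 t a w : 0 <= survival t a w.
Proof. by rewrite mulr_ge0// expR_ge0. Qed.

Lemma survival_le1 t a w : survival t a w <= 1.
Proof.
rewrite -[leRHS]mulr1 ler_pM// ?expR_ge0//; last by case: eqP.
by rewrite -[leRHS]expR0 ler_expR oppr_le0 occupation_ge0.
Qed.

Lemma survival_le_expR t a w : 0 <= t -> survival t a w <= expR (- t).
Proof.
move=> t0; rewrite -[leRHS]mulr1 ler_pM// ?expR_ge0//; last by case: eqP.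
rewrite ler_expR lerN2 -[leLHS](subr0 t) -[leLHS]mul1r.
rewrite -(occupation_cst X 1 w t0).
exact: (le_occupation mX rcX 0 t w kappa_ge1).
Qed.

Let integrable_survival i t a : (P i).-integrable setT (EFin \o survival t a).
Proof.
apply: (@probability_bounded_integrable _ _ _ _ _ 1); first exact: measurable_survival.
by move=> w; rewrite ger0_norm ?survival_ge0// survival_le1.
Qed.

Let Rintegral_prob_cst i (c : R) : \int[P i]_w c = c.
Proof. by rewrite Rintegral_cst//= probability_setT mulr1. Qed.

Lemma killed_semigroup_ge0 t i a : 0 <= psi t i a.
Proof. by apply: Rintegral_ge0 => w _; exact: survival_ge0. Qed.

Lemma killed_semigroup_le_expR t i a : 0 <= t -> psi t i a <= expR (- t).
Proof.
move=> t0; rewrite -[leRHS](Rintegral_prob_cst i); apply: le_Rintegral => //.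
- exact: integrable_survival.
- exact: finite_measure_integrable_cst.
- by move=> w _; exact: survival_le_expR.
Qed.

Lemma measurable_killed_semigroup i a : measurable_fun setT (fun t : mR => psi t i a).
Proof.
apply: measurableT_comp; first exact: fine_measurable.
pose f (z : mR * Om) := (survival z.1 a z.2)%:E.
apply: (measurable_fun_fubini_tonelli_F (m2 := P i) f).
  by apply/measurable_EFinP; exact: measurable_survival_pair.
by move=> z; rewrite lee_fin survival_ge0.
Qed.

Let riemann_times N (t : R) : seq (R * (Lam -> R)) :=
  [seq (m.+1%:R * (t / N.+1%:R), fun j => expR (- (kappa j * (t / N.+1%:R)))) |
    m <- iota 0 N.+1].

Let riemann_prod N t b w : \prod_(q <- riemann_times N t) q.2 (X (b + q.1) w) =
  expR (- \sum_(m < N.+1) kappa (X (b + m.+1%:R * (t / N.+1%:R)) w) * (t / N.+1%:R)).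
Proof.
rewrite /riemann_times big_map -sumrN expR_sum -[iota 0 N.+1]/(index_iota 0 N.+1) big_mkord.
by [].
Qed.

Let path_riemann N t : 0 <= t -> path <=%R 0 (rcons (unzip1 (riemann_times N t)) t).
Proof.
move=> t0; pose dl := t / N.+1%:R.
have dl0 : 0 <= dl by rewrite divr_ge0.
have -> : unzip1 (riemann_times N t) = [seq m.+1%:R * dl | m <- iota 0 N.+1].
  by rewrite /unzip1 -map_comp.
suff h n k : path <=%R (k%:R * dl)
    (rcons [seq m.+1%:R * dl | m <- iota k n] ((k + n)%:R * dl)).
  have := h N.+1 0%N; rewrite mul0r add0n.
  by rewrite (_ : N.+1%:R * dl = t)// /dl mulrCA divff ?mulr1.
elim: n k => [|n IH] k /=; first by rewrite addn0 lexx.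
by rewrite addnS -addSn IH andbT ler_wpM2r// ler_nat.
Qed.

Let riemann_cvg b t w : 0 <= t ->
  \prod_(q <- riemann_times N t) q.2 (X (b + q.1) w) @[N --> \oo] -->
  expR (- occupation X kappa b (b + t) w).
Proof.
move=> t0; under eq_fun do rewrite riemann_prod.
apply: (continuous_cvg _ (@continuous_expR R _)); apply: cvgN.
exact: riemann_occupation_cvg.
Qed.

Let riemann_bound N t b w : 0 <= t ->
  0 <= \prod_(q <- riemann_times N t) q.2 (X (b + q.1) w) <= 1.
Proof.
move=> t0; rewrite riemann_prod expR_ge0 -[leRHS]expR0 ler_expR oppr_le0.
by apply: sumr_ge0 => m _; rewrite mulr_ge0// divr_ge0.
Qed.

Let measurable_riemann N t b : measurable_fun setT
  (fun w => \prod_(q <- riemann_times N t) q.2 (X (b + q.1) w)).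
Proof.
under eq_fun do rewrite riemann_prod.
apply: measurableT_comp; first exact: measurable_expR.
apply: measurable_funN; apply: measurable_sum => m.
apply: measurable_funM; last exact: measurable_cst.
exact: (measurable_state mX kappa).
Qed.

Let measurable_at t x : measurable_fun setT (fun w => (X t w == x)%:R : R).
Proof. exact: (measurable_state mX (fun j => (j == x)%:R)). Qed.

Let dominated1 i (f_ : nat -> Om -> R) (f : Om -> R) :
  (forall n, measurable_fun setT (f_ n)) ->
  (forall w, f_ ^~ w @ \oo --> f w) -> (forall n w, `|f_ n w| <= 1) ->
  \int[P i]_w f_ n w @[n --> \oo] --> \int[P i]_w f w.
Proof.
move=> mf_ ff f1.
have mf : measurable_fun setT f.
  by apply: (@measurable_fun_cvg _ _ _ _ f_) => // w _; exact: ff.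
have [] // := @Rintegral_dominated_cvg _ _ _ (P i) setT f_ f (cst 1) measurableT mf_ mf.
- by apply: aeW => w _; exact: ff.
- exact: finite_measure_integrable_cst.
Qed.

(** The exponential of an occupation time depends on the whole path, while [markov_property] covers
    finitely many times. With both occupation times replaced by Riemann sums the factorisation is
    exact for each N, and both sides pass to the limit by dominated convergence. *)
Lemma killed_semigroup_chapman_kolmogorov t s i a : 0 <= t -> 0 <= s ->
  psi (t + s) i a = \sum_j psi t i j * psi s j a.
Proof.
move=> t0 s0.
pose A N t b w := \prod_(q <- riemann_times N t) q.2 (X (b + q.1) w).
have A01 N t' b w : 0 <= t' -> 0 <= A N t' b w <= 1 by exact: riemann_bound.
have limA t' j x : 0 <= t' ->
    \int[P j]_w (A N t' 0 w * (X t' w == x)%:R) @[N --> \oo] --> psi t' j x.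
  move=> t'0; apply: dominated1.
  - by move=> N; apply: measurable_funM; [exact: measurable_riemann|exact: measurable_at].
  - move=> w; apply: cvgM; last exact: cvg_cst.
    by have := @riemann_cvg 0 t' w t'0; rewrite add0r.
  - move=> N w; have /andP[h1 h2] := A01 N t' 0 w t'0.
    by rewrite normrM (ger0_norm h1) normr_nat mulr_ile1//; case: eqP.
have -> : psi (t + s) i a = \sum_j \int[P i]_w (expR (- occupation X kappa 0 t w) *
    (X t w == j)%:R * (expR (- occupation X kappa t (t + s) w) * (X (t + s) w == a)%:R)).
  rewrite -Rintegral_sum.
    apply: eq_Rintegral => w _; rewrite (bigD1 (X t w))//= eqxx mulr1.
    rewrite big1 ?addr0; last by move=> j jX; rewrite eq_sym (negbTE jX) mulr0 mul0r.
    rewrite /survival (occupation_split mX rcX kappa w t0 (_ : t <= t + s)) ?lerDl//.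
    by rewrite opprD expRD mulrA.
  move=> j; apply: (@probability_bounded_integrable _ _ _ _ _ 1).
    rewrite (_ : (fun _ => _) = (fun w => survival (t + s) a w * (X t w == j)%:R)).
      by apply: measurable_funM; [exact: measurable_survival|exact: measurable_at].
    apply/funext => w; rewrite /survival.
    rewrite (occupation_split mX rcX kappa w t0 (_ : t <= t + s)) ?lerDl//.
    by rewrite opprD expRD; ring.
  move=> w; rewrite !normrM !normr_nat !(ger0_norm (expR_ge0 _)).
  apply: mulr_ile1; rewrite ?mulr_ge0 ?expR_ge0//.
    apply: mulr_ile1; rewrite ?expR_ge0//; last by case: eqP.
    by rewrite -[leRHS]expR0 ler_expR oppr_le0 occupation_ge0.
  apply: mulr_ile1; rewrite ?expR_ge0//; last by case: eqP.
  by rewrite -[leRHS]expR0 ler_expR oppr_le0 occupation_ge0.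
apply: eq_bigr => j _.
pose L N := \int[P i]_w (A N t 0 w * (X t w == j)%:R * (A N s t w * (X (t + s) w == a)%:R)).
have L1 : L N @[N --> \oo] --> psi t i j * psi s j a.
  have -> : L = fun N => (\int[P i]_w (A N t 0 w * (X t w == j)%:R)) *
      (\int[P j]_w (A N s 0 w * (X s w == a)%:R)).
    apply/funext => N; rewrite /L.
    have := @markov_property _ _ _ _ X mX P p markovX i t j (riemann_times N t)
      (rcons (riemann_times N s) (s, fun x => (x == a)%:R)) (path_riemann N t0).
    rewrite /unzip1 map_rcons => /(_ (path_riemann N s0)).
    have A0 t' w : A N t' 0 w = \prod_(q <- riemann_times N t') q.2 (X q.1 w).
      by apply: eq_bigr => q _; rewrite add0r.
    move=> h; transitivity (\int[P i]_w ((\prod_(q <- riemann_times N t) q.2 (X q.1 w)) *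
        (X t w == j)%:R * \prod_(q <- rcons (riemann_times N s) (s, fun x => (x == a)%:R))
          q.2 (X (t + q.1) w))).
      by apply: eq_Rintegral => w _; rewrite A0 big_rcons.
    rewrite h; congr (_ * _); apply: eq_Rintegral => w _.
      by rewrite A0.
    by rewrite A0 big_rcons.
  by apply: cvgM; exact: limA.
have L2 : L N @[N --> \oo] --> \int[P i]_w (expR (- occupation X kappa 0 t w) *
    (X t w == j)%:R * (expR (- occupation X kappa t (t + s) w) * (X (t + s) w == a)%:R)).
  apply: dominated1.
  - move=> N; apply: measurable_funM; apply: measurable_funM;
      by [exact: measurable_riemann|exact: measurable_at].
  - move=> w; apply: cvgM; apply: cvgM; try exact: cvg_cst.
      by have := @riemann_cvg 0 t w t0; rewrite add0r.
    exact: riemann_cvg.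
  - move=> N w; have /andP[h1 h2] := A01 N t 0 w t0; have /andP[h3 h4] := A01 N s t w s0.
    rewrite !normrM !normr_nat (ger0_norm h1) (ger0_norm h3).
    apply: mulr_ile1; rewrite ?mulr_ge0//; apply: mulr_ile1 => //; by case: eqP.
by rewrite -(cvg_lim (@norm_hausdorff _ _) L2) (cvg_lim (@norm_hausdorff _ _) L1).
Qed.

Let K := \sum_i kappa i.

Let kappa_leK i : kappa i <= K.
Proof. by rewrite /K (bigD1 i)//= lerDl sumr_ge0. Qed.

Let occ_le t w : 0 <= t -> occupation X kappa 0 t w <= K * t.
Proof.
move=> t0; rewrite -[X in K * X]subr0 -(occupation_cst X K w t0).
exact: (le_occupation mX rcX 0 t w kappa_leK).
Qed.

Let integrable_at i t x (c : R) : (P i).-integrable setT (EFin \o (fun w => c * (X t w == x)%:R)).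
Proof.
apply: (@probability_bounded_integrable _ _ _ _ _ `|c|).
  by apply: measurable_funM => //; exact: measurable_at.
by move=> w; rewrite normrM normr_nat ler_piMr//; case: eqP.
Qed.

Let killed_semigroup_le t i a : 0 <= t -> psi t i a <= p t i a.
Proof.
move=> t0; rewrite -(markov_one mX markovX i a t0); apply: le_Rintegral => //.
- exact: integrable_survival.
- by have := integrable_at i t a 1; apply: eq_integrable => // w _ /=; rewrite mul1r.
move=> w _; rewrite /survival ler_piMl//.
by rewrite -[leRHS]expR0 ler_expR oppr_le0 occupation_ge0.
Qed.

(** From exp(-x) >= 1 - x and the crude bound K t on the occupation time. Together with the upper
    bound by p, this identifies the off-diagonal rates of the killed semigroup with those of the
    walk. *)
Let killed_semigroup_ge t i a : 0 <= t -> (1 - K * t) * p t i a <= psi t i a.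
Proof.
move=> t0; rewrite -(markov_one mX markovX i a t0) -RintegralZl//; last first.
  by have := integrable_at i t a 1; apply: eq_integrable => // w _ /=; rewrite mul1r.
apply: le_Rintegral => //.
- exact: integrable_at.
- exact: integrable_survival.
move=> w _; rewrite /survival ler_wpM2r//.
by apply: le_trans (expR_ge1Dx _); rewrite lerD2l lerN2 occ_le.
Qed.

(** Off the diagonal p(t) is t times a convergent quotient; the diagonal then follows because the
    rows sum to 1. *)
Let p_cvg0 i a : p t i a @[t --> 0^'+] --> ((i == a)%:R : R).
Proof.
have off x j : x != j -> p t x j @[t --> 0^'+] --> (0 : R).
  move=> ij; have h := tf_rate tp ij.
  have h2 : p t x j / t * t @[t --> 0^'+] --> (0 : R).
    rewrite -[X in _ --> X](mulr0 (beta x j)); apply: cvgM => //.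
    exact: cvg_at_right_filter (cvg_id).
  apply: cvg_trans h2; apply: near_eq_cvg; near=> t.
  by rewrite divfK// gt_eqF//; near: t; exact: nbhs_right_gt.
have [->|ia] := eqVneq i a; last exact: off.
have h : (1 - \sum_(j | j != a) p t a j) @[t --> 0^'+] --> (1 : R).
  rewrite -[X in _ --> X]subr0; apply: cvgB; first exact: cvg_cst.
  rewrite [X in _ --> X](_ : 0 = \sum_(j | j != a) (0 : R)); last by rewrite big1.
  apply: cvgr_sum => j ja.
  by apply: off; rewrite eq_sym.
apply: cvg_trans h; apply: near_eq_cvg; near=> t.
have t0 : 0 < t by near: t; exact: nbhs_right_gt.
have := tf_sum1 tp a (ltW t0); rewrite (bigD1 a)//= => <-; rewrite addrK.
by [].
Unshelve. all: by end_near. Qed.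

Let killed_semigroup_cvg0 i a : psi t i a @[t --> 0^'+] --> ((i == a)%:R : R).
Proof.
have h : (1 - K * t) * p t i a @[t --> 0^'+] --> ((i == a)%:R : R).
  rewrite -[X in _ --> X]mul1r; apply: cvgM; last exact: p_cvg0.
  rewrite -[X in _ --> X]subr0; apply: cvgB; first exact: cvg_cst.
  rewrite -[X in _ --> X](mulr0 K); apply: cvgM; first exact: cvg_cst.
  exact: cvg_at_right_filter (cvg_id).
have h2 := p_cvg0 (i := i) (a := a). apply: (squeeze_cvgr _ h h2); near=> t.
have t0 : 0 < t by near: t; exact: nbhs_right_gt.
by rewrite killed_semigroup_ge ?killed_semigroup_le ?ltW.
Unshelve. all: by end_near. Qed.

Let dl n : R := n.+1%:R^-1.

Let dl_gt0 n : 0 < dl n. Proof. by rewrite invr_gt0. Qed.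

Let dl_cvg : dl n @[n --> \oo] --> (0 : R).
Proof. exact: cvg_harmonic. Qed.

Let rate_cvg i j : i != j -> n.+1%:R * p (dl n) i j @[n --> \oo] --> beta i j.
Proof.
move=> ij.
have := (cvg_at_rightP _ _ _).1 (tf_rate tp ij) dl (conj dl_gt0 dl_cvg).
by under eq_fun do rewrite /dl invrK mulrC.
Qed.

(** The sandwich between (1 - K t) p and p is too coarse on the diagonal, where the first-order
    coefficient itself is wanted. Almost every path starts at a and stays there for a positive time,
    so for large n its occupation time is exactly [kappa a * dl n]; the integrands are dominated by
    K. *)
Let kill_rate a :
  n.+1%:R * \int[P a]_w ((1 - expR (- occupation X kappa 0 (dl n) w)) * (X (dl n) w == a)%:R)
    @[n --> \oo] --> kappa a.
Proof.
pose f_ n w := n.+1%:R * ((1 - expR (- occupation X kappa 0 (dl n) w)) * (X (dl n) w == a)%:R).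
have occ0 n w : 0 <= occupation X kappa 0 (dl n) w by exact: occupation_ge0.
have e01 n w : 0 <= 1 - expR (- occupation X kappa 0 (dl n) w) <= K * dl n.
  rewrite subr_ge0 -[X in _ <= X]expR0 ler_expR oppr_le0 occ0/=.
  apply: le_trans (occ_le w (ltW (dl_gt0 n))).
  by rewrite lerBlDr -lerBlDl expR_ge1Dx.
have mE n : measurable_fun setT
    (fun w => (1 - expR (- occupation X kappa 0 (dl n) w)) * (X (dl n) w == a)%:R).
  apply: measurable_funM; last exact: measurable_at.
  apply: measurable_funB => //; apply: measurableT_comp; first exact: measurable_expR.
  exact: measurable_funN.
have bE n w : 0 <= (1 - expR (- occupation X kappa 0 (dl n) w)) * (X (dl n) w == a)%:R <= K * dl n.
  have /andP[h1 h2] := e01 n w; rewrite mulr_ge0//=.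
  by rewrite (le_trans _ h2)// ler_piMr//; case: eqP.
have -> : (fun n => n.+1%:R * \int[P a]_w ((1 - expR (- occupation X kappa 0 (dl n) w)) *
    (X (dl n) w == a)%:R)) = fun n => \int[P a]_w f_ n w.
  apply/funext => n; rewrite RintegralZl//.
  apply: (@probability_bounded_integrable _ _ _ _ _ (K * dl n)) => // w.
  by have /andP[h1 h2] := bE n w; rewrite ger0_norm.
rewrite -[X in _ --> X](Rintegral_prob_cst a).
have [] // := @Rintegral_dominated_cvg _ _ _ (P a) setT f_ (cst (kappa a)) (cst K) measurableT.
- by move=> n; exact: measurable_funM.
(* The law of the state at time 0 is read off from the one-point list (0, a), since p at time 0 is
   the identity. *)
- have PX0 : P a [set w | X 0 w = a] = 1%E.
    have := markovX a (s := [:: (0, a)]).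
    rewrite /= lexx subrr (tf_0 tp) eqxx mulr1 => /(_ isT) <-.
    congr (P a _); apply/seteqP; split => w /=.
      by move=> h q; rewrite inE => /eqP ->.
    by move=> /(_ (0, a)) /=; rewrite inE eqxx => /(_ isT).
  exists (~` [set w | X 0 w = a]); split.
  + exact: measurableC.
  + by have := probability_setC (P a) (mX 0 a); rewrite PX0 subee.
  + apply: subsetC => w /= X0 _; rewrite /cst/=.
    have [e e0 he] := right_continuous_ex rcX w 0.
    rewrite X0 in he.
    (* The two bounds come from x / (1 + x) <= 1 - exp(-x) <= x at x = [kappa a * dl n], multiplied
       by n + 1. *)
    have lo : kappa a / (1 + kappa a * dl n) @[n --> \oo] --> kappa a.
      rewrite -[X in _ --> X](divr1 (kappa a)); apply: cvgM; first exact: cvg_cst.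
      apply: cvgV; first exact: oner_neq0.
      rewrite -[X in _ --> X]addr0; apply: cvgD; first exact: cvg_cst.
      by rewrite -[X in _ --> X](mulr0 (kappa a)); apply: cvgM => //; exact: cvg_cst.
    have hi : kappa a @[n --> \oo] --> kappa a by exact: cvg_cst.
    apply: (squeeze_cvgr _ lo hi); near=> n.
    have dle : dl n < e by near: n; exact: (near_infty_natSinv_lt (PosNum e0)).
    have occE : occupation X kappa 0 (dl n) w = kappa a * dl n.
      transitivity (occupation X (fun=> kappa a) 0 (dl n) w).
        apply: eq_Rintegral => r; rewrite inE/= in_itv/= => /andP[r0 rd].
        by rewrite he// r0 add0r (le_lt_trans rd).
      by rewrite (occupation_cst X)// ?subr0// ltW.
    rewrite /f_ occE he ?eqxx ?mulr1; last by rewrite add0r dle ltW.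
    have k0 : 0 < kappa a by exact: lt_le_trans (kappa_ge1 a).
    set x := kappa a * dl n.
    have x0 : 0 <= x by rewrite mulr_ge0// ltW.
    have nx : n.+1%:R * x = kappa a by rewrite /x /dl mulrCA divff ?mulr1.
    apply/andP; split.
      rewrite -{1}nx -mulrA ler_wpM2l// expRN.
      have x1 : 0 < 1 + x by rewrite ltr_wpDr.
      apply: le_trans (_ : 1 - (1 + x)^-1 <= _).
        by rewrite ler_pdivrMr// mulrBl mulVf ?gt_eqF// mul1r addrAC subrr add0r.
      by rewrite lerD2l lerN2 lef_pV2 ?expR_ge1Dx// posrE// expR_gt0.
    rewrite -[leRHS]nx ler_wpM2l// lerBlDr -lerBlDl expR_ge1Dx//.
- exact: finite_measure_integrable_cst.
- move=> n w _; have /andP[h1 h2] := bE n w.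
  have KE : K = n.+1%:R * (K * dl n) by rewrite /dl mulrCA divff ?mulr1.
  have f0 : 0 <= f_ n w by rewrite /f_ mulr_ge0.
  rewrite ger0_norm//; apply: (le_trans (ler_wpM2l _ h2)) => //.
  by rewrite -KE.
Unshelve. all: by end_near. Qed.

(** The limits are the entries of kappa - Delta_beta. On the diagonal, 1 - psi(a, a) is split by the
    row sum of p into a loss from ending elsewhere, with rates beta, and a loss from killing, given
    by [kill_rate]. *)
Let generator_cvg j a :
  n.+1%:R * ((j == a)%:R - psi (dl n) j a) @[n --> \oo] -->
  (if j == a then \sum_(l | l != a) beta a l + kappa a else - beta j a).
Proof.
have [->|ja] := eqVneq j a; last first.
  under eq_fun do rewrite sub0r mulrN; apply: cvgN.
  have lo : (1 - K * dl n) * (n.+1%:R * p (dl n) j a) @[n --> \oo] --> beta j a.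
    rewrite -[X in _ --> X]mul1r; apply: cvgM; last exact: rate_cvg.
    rewrite -[X in _ --> X]subr0; apply: cvgB; first exact: cvg_cst.
    by rewrite -[X in _ --> X](mulr0 K); apply: cvgM => //; exact: cvg_cst.
  have hi := rate_cvg ja; apply: (squeeze_cvgr _ lo hi); near=> n.
  have d0 := ltW (dl_gt0 n).
  by rewrite mulrCA !ler_wpM2l ?killed_semigroup_ge ?killed_semigroup_le.
have -> : (fun n => n.+1%:R * (1 - psi (dl n) a a)) = (fun n =>
    \sum_(l | l != a) (n.+1%:R * p (dl n) a l) +
    n.+1%:R * \int[P a]_w ((1 - expR (- occupation X kappa 0 (dl n) w)) * (X (dl n) w == a)%:R)).
  apply/funext => n; rewrite -mulr_sumr -mulrDr; congr (_ * _).
  have d0 := ltW (dl_gt0 n).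
  have i1 : (P a).-integrable setT (EFin \o (fun w => (X (dl n) w == a)%:R : R)).
    by have := integrable_at a (dl n) a 1; apply: eq_integrable => // w _ /=; rewrite mul1r.
  have -> : \int[P a]_w ((1 - expR (- occupation X kappa 0 (dl n) w)) *
      (X (dl n) w == a)%:R) = p (dl n) a a - psi (dl n) a a.
    rewrite -(markov_one mX markovX a a d0) -RintegralB//; last exact: integrable_survival.
    by apply: eq_Rintegral => w _; rewrite mulrBl mul1r.
  by have := tf_sum1 tp a d0; rewrite (bigD1 a)//= => <-; ring.
apply: cvgD; last exact: kill_rate.
apply: cvgr_sum => l la.
by apply: rate_cvg; rewrite eq_sym.
Unshelve. all: by end_near. Qed.

Lemma integrable_killed_semigroup i a :
  leb.-integrable `[0, +oo[ (EFin \o (fun t => psi t i a)).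
Proof.
apply: (@le_integrable _ _ _ leb _ _ _ (EFin \o exponential_pdf 1)) => //.
- by apply/measurable_EFinP; apply: measurable_funTS; exact: measurable_killed_semigroup.
- move=> t /=; rewrite in_itv/= andbT => t0.
  rewrite lee_fin exponential_pdfE// ger0_norm ?killed_semigroup_ge0//.
  rewrite (le_trans (killed_semigroup_le_expR i a t0))// /exponential_pdf.
  by rewrite mulN1r mul1r ler_norm.
- apply: (@integrableS _ _ _ leb setT) => //.
  exact: integrable_exponential_pdf.
Qed.

Definition killed_resolvent i a : R := \int[leb]_(t in `[0, +oo[) psi t i a.

Local Notation G := killed_resolvent.

Lemma killed_resolventE i a :
  (\int[leb]_(t in `[0%R, +oo[) (psi t i a)%:E)%E = (G i a)%:E.
Proof.
rewrite /G /Rintegral fineK//; apply: integrable_fin_num => //.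
exact: integrable_killed_semigroup.
Qed.

(** Chapman-Kolmogorov turns the left side into the integral of psi(t + dt) over t >= 0. The cut-off
    at dt is put into the integrand [g], so that translation invariance on the whole line can be
    used. *)
Let resolvent_tail i a dt : 0 <= dt ->
  \sum_j G i j * psi dt j a = \int[leb]_(t in `[dt, +oo[) psi t i a.
Proof.
move=> dt0.
pose g (t : mR) : \bar R := if dt <= t then (psi t i a)%:E else 0%E.
have mg : measurable_fun setT g.
  apply: measurable_fun_ifT => //; last first.
    by apply/measurable_EFinP; exact: measurable_killed_semigroup.
  exact: measurable_fun_ler.
have g0 t : (0 <= g t)%E by rewrite /g; case: ifP => // _; rewrite lee_fin killed_semigroup_ge0.
apply: EFin_inj.
transitivity (\int[leb]_t g t)%E; last first.
  rewrite /Rintegral fineK; last first.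
    apply: integrable_fin_num => //.
    apply: integrableS (integrable_killed_semigroup i a) => //.
    by apply: subset_itvr; rewrite bnd_simp.
  rewrite [RHS]integral_mkcond; apply: eq_integral => t _.
  by rewrite /g /patch mem_setE in_itv/= andbT.
rewrite -(integral_lebesgue_translation dt mg g0).
transitivity (\int[leb]_(t in `[0%R, +oo[) (\sum_j psi t i j * psi dt j a)%:E)%E.
  rewrite -sumEFin; under [in RHS]eq_integral do rewrite -sumEFin.
  rewrite ge0_integral_sum//.
  - apply: eq_bigr => j _; rewrite EFinM -killed_resolventE -ge0_integralZr//.
    + by apply/measurable_EFinP; apply: measurable_funTS; exact: measurable_killed_semigroup.
    + by move=> t _; rewrite lee_fin killed_semigroup_ge0.
    + by rewrite lee_fin killed_semigroup_ge0.
  - move=> j; apply/measurable_EFinP; apply: measurable_funM => //.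
    by apply: measurable_funTS; exact: measurable_killed_semigroup.
  - by move=> j t _; rewrite lee_fin mulr_ge0 ?killed_semigroup_ge0.
rewrite integral_mkcond; apply: eq_integral => t _.
rewrite /g /patch mem_setE in_itv/= andbT lerDr; case: ifP => // t0.
by rewrite -killed_semigroup_chapman_kolmogorov.
Qed.

Let resolvent_head i a n :
  \sum_j G i j * ((j == a)%:R - psi (dl n) j a) = \int[leb]_(t in `[0, dl n[) psi t i a.
Proof.
have d0 := ltW (dl_gt0 n).
under eq_bigr do rewrite mulrBr; rewrite sumrB resolvent_tail//.
rewrite (bigD1 a)//= eqxx mulr1 big1 ?addr0; last first.
  by move=> j /negbTE ->; rewrite mulr0.
have U : `[0, +oo[%classic = `[0, dl n[ `|` `[dl n, +oo[ :> set mR.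
  by rewrite -itv_bndbnd_setU// bnd_simp.
apply/eqP; rewrite subr_eq -Rintegral_setU//; first by rewrite /G U.
- by rewrite -U; exact: integrable_killed_semigroup.
- apply/disj_setPS => t [/=]; rewrite !in_itv/= andbT => /andP[_ td].
  by rewrite leNgt td.
Qed.

Let resolvent_average i a :
  n.+1%:R * \int[leb]_(t in `[0, dl n[) psi t i a @[n --> \oo] --> ((i == a)%:R : R).
Proof.
set c := (i == a)%:R.
apply/cvgrPdist_le => e e0.
have /cvgrPdist_le /(_ e e0) /nbhs_ballP[r /= r0 hr] := killed_semigroup_cvg0 (i := i) (a := a).
near=> n.
have d0 := dl_gt0 n.
have dr : dl n < r by near: n; exact: (near_infty_natSinv_lt (PosNum r0)).
have idl : leb.-integrable `]0, dl n[ (EFin \o (fun t => psi t i a)).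
  apply: integrableS (integrable_killed_semigroup i a) => // t /=.
  by rewrite !in_itv/= => /andP[/ltW ->].
have mu01 : fine (leb `]0, dl n[%classic) = dl n.
  by rewrite lebesgue_measure_itv/= lte_fin d0 -EFinB subr0.
have icst (x : R) : leb.-integrable `]0, dl n[ (EFin \o (fun=> x)).
  apply: measurable_bounded_integrable => //.
    by rewrite /= lebesgue_measure_itv/= lte_fin d0 -EFinB ltry.
  by exists `|x|; split; [rewrite num_real|move=> y /ltW xy t _].
(* The point 0 is removed because [killed_semigroup_cvg0] is a limit from the right and says nothing
   about the value at 0. *)
have -> : \int[leb]_(t in `[0, dl n[) psi t i a = \int[leb]_(t in `]0, dl n[) psi t i a.
  by rewrite Rintegral_itv_obnd_cbnd.
have -> : c = n.+1%:R * \int[leb]_(t in `]0, dl n[) c.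
  by rewrite Rintegral_cst//= mu01 /dl mulrCA divff ?mulr1.
rewrite -mulrBr normrM normr_nat -RintegralB//.
have -> : e = n.+1%:R * \int[leb]_(t in `]0, dl n[) e.
  by rewrite Rintegral_cst//= mu01 /dl mulrCA divff ?mulr1.
rewrite ler_wpM2l//.
have iB : leb.-integrable `]0, dl n[ (EFin \o (fun t => c - psi t i a)).
  exact: (integrableB _ (icst c) idl).
apply: le_trans (le_normr_Rintegral _ iB) _ => //.
apply: le_Rintegral => //; first exact: (integrable_norm iB).
move=> t /=; rewrite in_itv/= => /andP[t0 td].
apply: hr => //; rewrite /ball/= sub0r normrN ger0_norm ?ltW//.
exact: lt_trans td dr.
Unshelve. all: by end_near. Qed.

Hypothesis beta_sym : forall i j, beta i j = beta j i.

(* With G = int_0^oo psi_t dt one has (G - G psi_d)/d = d^-1 int_0^d psi_t dt;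
   both sides converge as d -> 0, to G (kappa - Delta_beta) and to the identity. *)
Theorem killed_resolvent_inverse i a :
  \sum_l beta a l * (G i a - G i l) + kappa a * G i a = (i == a)%:R.
Proof.
have h : \sum_j G i j * (n.+1%:R * ((j == a)%:R - psi (dl n) j a)) @[n --> \oo] -->
    \sum_j G i j * (if j == a then \sum_(l | l != a) beta a l + kappa a else - beta j a).
  apply: cvgr_sum => j _; apply: cvgM; first exact: cvg_cst.
  exact: generator_cvg.
have h2 : \sum_j G i j * (n.+1%:R * ((j == a)%:R - psi (dl n) j a)) @[n --> \oo] -->
    ((i == a)%:R : R).
  under eq_fun => n.
    under eq_bigr do rewrite mulrCA.
    rewrite -mulr_sumr resolvent_head; over.
  exact: resolvent_average.
rewrite -(cvg_lim (@norm_hausdorff _ _) h2) (cvg_lim (@norm_hausdorff _ _) h).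
rewrite (bigD1 a)//= [in RHS](bigD1 a)//= eqxx subrr mulr0 add0r.
rewrite mulrDr mulr_sumr addrAC; congr (_ + _); last by rewrite mulrC.
rewrite -big_split/=; apply: eq_bigr => l la.
by rewrite (negbTE la) (beta_sym l); ring.
Qed.

End feynman_kac.

(** * The tilted Hamiltonian *)

Section spin_algebra.
Context (R : realType) (Lam : finType) (n : nat).
Implicit Types (u : Lam -> 'rV[R]_n.+1) (v : 'rV[R]_n.+1).

Lemma dot_ge0 v : 0 <= dot v v.
Proof. by apply: sumr_ge0 => k _; rewrite -expr2 sqr_ge0. Qed.

Lemma dot_reflection v (c : R) :
  dot (- v - (2 * c) *: @e1 R n) (- v - (2 * c) *: @e1 R n) =
  dot v v + 4 * c * (v 0 ord0 + c).
Proof.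
rewrite /dot /e1 !(bigD1 ord0 (P := xpredT))//= !mxE/=.
rewrite [X in _ + X = _](_ : _ = \sum_(k | k != ord0) v 0 k * v 0 k); first by ring.
by apply: eq_bigr => k /negbTE k0; rewrite !mxE k0 andbF mulr0 subr0 mulrNN.
Qed.

(** The point reflection of each spin u_i through -m_i e^1. *)
Definition spin_reflection (m : Lam -> R) u : Lam -> 'rV[R]_n.+1 :=
  fun i => - u i - (2 * m i) *: @e1 R n.

Variables (beta : Lam -> Lam -> R) (h : Lam -> R).
Hypothesis beta_sym : forall i j, beta i j = beta j i.
Hypothesis beta_ge0 : forall i j, 0 <= beta i j.
Hypothesis h_ge0 : forall i, 0 <= h i.

Definition tilted_hamiltonian (s : R) (K : Lam -> R) u : R :=
  hamiltonian beta h u + \sum_i K i * half_sq_norms (theta s u) i.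

(* The hypothesis on m says that -m e^1 is the critical point of the tilted Hamiltonian. *)
Lemma tilted_hamiltonian_reflection s (K m : Lam -> R) u :
  (forall j, \sum_l beta j l * (m j - m l) + (h j + K j) * m j = s * K j) ->
  tilted_hamiltonian s K (spin_reflection m u) = tilted_hamiltonian s K u.
Proof.
(* Relative to the centre, each quadratic term changes under the reflection by a quantity linear in
   these y. *)
move=> mP; pose y i := u i 0 ord0 + m i.
have e1E i : spin_reflection m u i - spin_reflection m u i = 0 by rewrite subrr.
have d1 i j : dot (spin_reflection m u i - spin_reflection m u j)
      (spin_reflection m u i - spin_reflection m u j) =
    dot (u i - u j) (u i - u j) + 4 * (m i - m j) * (y i - y j).
  have -> : spin_reflection m u i - spin_reflection m u j =
      - (u i - u j) - (2 * (m i - m j)) *: @e1 R n.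
    by apply/rowP => k; rewrite !mxE; ring.
  by rewrite dot_reflection !mxE /y; congr (_ + _ * _); ring.
have d2 i : dot (spin_reflection m u i) (spin_reflection m u i) = dot (u i) (u i) + 4 * m i * y i.
  by rewrite dot_reflection.
have d3 i : half_sq_norms (theta s (spin_reflection m u)) i =
    half_sq_norms (theta s u) i + 2 * (m i - s) * y i.
  rewrite /half_sq_norms /sq_norms.
  have -> : theta s (spin_reflection m u) i = - theta s u i - (2 * (m i - s)) *: @e1 R n.
    by apply/rowP => k; rewrite !mxE; ring.
  by rewrite dot_reflection !mxE /= /y; field.
rewrite /tilted_hamiltonian /hamiltonian.
under eq_bigr do under eq_bigr do rewrite d1 mulrDr.
under [\sum_i h i * _]eq_bigr do rewrite d2 mulrDr.
under [\sum_i K i * half_sq_norms (theta s (spin_reflection m u)) i]eq_bigr do rewrite d3 mulrDr.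
under eq_bigr do rewrite big_split/=.
rewrite !big_split/=.
set A := \sum_i \sum_j beta i j * dot _ _.
set B := \sum_i h i * dot _ _.
set C := \sum_i K i * half_sq_norms _ _.
set A' := \sum_i \sum_j _.
set B' := \sum_i _.
set C' := \sum_i _.
suff : A' + 2 * B' + 4 * C' = 0.
  move=> h0; have -> : 4^-1 * (A + A') + 2^-1 * (B + B') + (C + C') =
     4^-1 * A + 2^-1 * B + C + 4^-1 * (A' + 2 * B' + 4 * C') by field.
  by rewrite h0 mulr0 addr0.
(* Summation by parts: by symmetry of beta, the terms in y_i and in y_j contribute equally. The
   coefficient of each y_i in the total is then zero by the hypothesis on m. *)
have -> : A' = 8 * \sum_i y i * \sum_j beta i j * (m i - m j).
  transitivity (4 * (\sum_i \sum_j beta i j * (m i - m j) * y i -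
      \sum_i \sum_j beta i j * (m i - m j) * y j)).
    rewrite -sumrB mulr_sumr; apply: eq_bigr => i _.
    rewrite -sumrB mulr_sumr; apply: eq_bigr => j _; ring.
  rewrite [X in _ - X]exchange_big/=.
  have -> : \sum_j \sum_i beta i j * (m i - m j) * y j =
      - \sum_i \sum_j beta i j * (m i - m j) * y i.
    rewrite -sumrN; apply: eq_bigr => i _; rewrite -sumrN.
    by apply: eq_bigr => j _; rewrite beta_sym; ring.
  have -> : \sum_i \sum_j beta i j * (m i - m j) * y i =
      \sum_i y i * \sum_j beta i j * (m i - m j).
    by apply: eq_bigr => i _; rewrite mulr_sumr; apply: eq_bigr => j _; rewrite mulrC.
  by ring.
rewrite /B' /C' !mulr_sumr -!big_split/= big1// => i _.
have -> : \sum_j beta i j * (m i - m j) = s * K i - (h i + K i) * m i.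
  by rewrite -mP addrK.
ring.
Qed.

Let ham_terms_ge0 u : (forall i j, 0 <= beta i j * dot (u i - u j) (u i - u j)) /\
  forall i, 0 <= h i * dot (u i) (u i).
Proof. by split => *; rewrite mulr_ge0 ?dot_ge0. Qed.

Lemma hamiltonian_ge0 u : 0 <= hamiltonian beta h u.
Proof.
have [h1 h2] := ham_terms_ge0 u.
rewrite addr_ge0// mulr_ge0// sumr_ge0// => i _; apply: sumr_ge0 => j _; exact: h1.
Qed.

Let dot_sub_le u i j : beta i j * dot (u i - u j) (u i - u j) <= 4 * hamiltonian beta h u.
Proof.
have [h1 h2] := ham_terms_ge0 u; rewrite /hamiltonian mulrDr mulrA divff// mul1r.
rewrite (bigD1 i)//= (bigD1 j)//= -!addrA lerDl !addr_ge0//.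
- by apply: sumr_ge0 => l _; exact: h1.
- by apply: sumr_ge0 => l _; apply: sumr_ge0 => l' _; exact: h1.
- by rewrite !mulr_ge0// sumr_ge0.
Qed.

Let dot_le u i : h i * dot (u i) (u i) <= 2 * hamiltonian beta h u.
Proof.
have [h1 h2] := ham_terms_ge0 u; rewrite /hamiltonian mulrDr.
rewrite [2 * (2^-1 * _)]mulrA divff// mul1r (bigD1 i (P := xpredT) (F := fun i => h i * _))//=.
rewrite addrCA lerDl addr_ge0//; last exact: sumr_ge0.
rewrite !mulr_ge0//; apply: sumr_ge0 => l _; apply: sumr_ge0 => l' _; exact: h1.
Qed.

Lemma dot_add_le v v' : dot v' v' <= 2 * dot v v + 2 * dot (v - v') (v - v').
Proof.
rewrite /dot !mulr_sumr -big_split/=; apply: ler_sum => k _; rewrite !mxE.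
(* The difference of the two sides, component by component, is exactly this square. *)
have := sqr_ge0 (2 * v 0 k - v' 0 k).
nra.
Qed.

Hypothesis beta_connected : forall i j, connect (fun x y => 0 < beta x y) i j.
Hypothesis h_neq0 : h <> (fun=> 0).

(** A site with h_i > 0 has its own spin controlled by the mass term. The bound travels along a path
    of positive edges to j: each gradient term controls the next spin by the previous one. *)
Let site_bound j : exists2 C : R, 0 <= C &
  forall u, dot (u j) (u j) <= C * hamiltonian beta h u.
Proof.
have [i hi] : exists i, 0 < h i.
  apply/not_existsP => hn; apply: h_neq0; apply/funext => i.
  by apply/eqP; rewrite eq_le h_ge0 andbT leNgt; apply/negP; exact: hn.
have /connectP[q] := beta_connected i j.
have : exists2 C : R, 0 <= C & forall u, dot (u i) (u i) <= C * hamiltonian beta h u.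
  exists (2 / h i); first by rewrite divr_ge0.
  by move=> u; rewrite mulrAC ler_pdivlMr// mulrC dot_le.
elim: q i {hi} => [|x q IH] i [C C0 hC] /=; first by move=> _ ->; exists C.
move=> /andP[ix xq] jE; apply: (IH x) => //.
exists (2 * C + 2 * (4 / beta i x)).
  by rewrite addr_ge0// mulr_ge0// divr_ge0.
move=> u; apply: le_trans (dot_add_le (u i) (u x)) _.
have -> : (2 * C + 2 * (4 / beta i x)) * hamiltonian beta h u =
    2 * (C * hamiltonian beta h u) + 2 * (4 / beta i x * hamiltonian beta h u) by ring.
apply: lerD; rewrite ler_wpM2l//.
by rewrite mulrAC ler_pdivlMr// mulrC dot_sub_le.
Qed.

Lemma hamiltonian_coercive : exists2 e : R, 0 < e &
  forall u, e * \sum_i dot (u i) (u i) <= hamiltonian beta h u.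
Proof.
have [C C0 hC] : exists2 C : R, 0 <= C &
    forall u, \sum_i dot (u i) (u i) <= C * hamiltonian beta h u.
  elim: (index_enum Lam) => [|i r [C C0 IH]].
    by exists 0 => // u; rewrite big_nil mul0r.
  have [C' C'0 hC'] := site_bound i.
  exists (C' + C); first exact: addr_ge0.
  by move=> u; rewrite big_cons mulrDl lerD.
(* C is only known to be nonnegative, so 1 is added before inverting. *)
exists (C + 1)^-1; first by rewrite invr_gt0 ltr_wpDl.
move=> u; rewrite mulrC ler_pdivrMr ?ltr_wpDl// mulrC.
by rewrite (le_trans (hC u))// ler_wpM2r ?hamiltonian_ge0// lerDl.
Qed.

End spin_algebra.

(** * Gaussian integrals over spin configurations *)

Section spin_integrals.
Context (R : realType) (Lam : finType) (n : nat).
Local Notation mR := (measurableTypeR R).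
Local Notation leb := (@lebesgue_measure R).
Local Notation N := #|{: Lam * 'I_n.+1}|.
Local Notation U := (N.-tuple mR).
Local Notation mu := (tuple_measure leb N).
Local Notation cfg t := (config (t : N.-tuple R)).
Implicit Type t : U.

Lemma configE t i k : cfg t i 0 k = tnth t (enum_rank (i, k)).
Proof. by rewrite mxE. Qed.

Lemma measurable_config i k : measurable_fun setT (fun t => cfg t i 0 k : R).
Proof.
under eq_fun do rewrite configE.
exact: (@measurable_tnth _ mR).
Qed.

Lemma sum_dot_config t : \sum_i dot (cfg t i) (cfg t i) = \sum_j tnth t j ^+ 2.
Proof.
rewrite /dot (pair_big xpredT xpredT (fun i k => cfg t i 0 k * cfg t i 0 k))/=.
rewrite [RHS](reindex (@enum_rank {: Lam * 'I_n.+1}))/=; last first.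
  by exists enum_val => x _; rewrite ?enum_rankK ?enum_valK.
by apply: eq_bigr => -[i k] _; rewrite configE expr2.
Qed.

Lemma measurable_half_sq_norms s i :
  measurable_fun setT (fun t => half_sq_norms (theta s (cfg t)) i : R).
Proof.
apply: measurable_funM => //; apply: measurable_sum => k.
suff h : measurable_fun setT (fun t => theta s (cfg t) i 0 k : R).
  exact: measurable_funM.
have -> : (fun t => theta s (cfg t) i 0 k) = (fun t => cfg t i 0 k + s * @e1 R n 0 k).
  by apply/funext => t; rewrite /theta !mxE.
by apply: measurable_funD => //; exact: measurable_config.
Qed.

Lemma half_sq_norms_ge0 (u : Lam -> 'rV[R]_n.+1) i : 0 <= half_sq_norms u i.
Proof. by rewrite mulr_ge0// dot_ge0. Qed.

Lemma half_sq_norms_le s (u : Lam -> 'rV[R]_n.+1) i :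
  half_sq_norms (theta s u) i <= dot (u i) (u i) + s ^+ 2.
Proof.
rewrite /half_sq_norms /sq_norms ler_pdivrMl//.
have := dot_add_le (u i) (theta s u i); rewrite /theta opprD addNKr.
have -> : dot (- (s *: @e1 R n)) (- (s *: @e1 R n)) = s ^+ 2.
  rewrite /dot (bigD1 ord0)//= /e1 !mxE/= big1; first by rewrite !mulr1 mulrNN addr0.
  by move=> k /negbTE k0; rewrite !mxE k0 andbF mulr0 oppr0 mulr0.
by rewrite mulrDr.
Qed.

Variables (beta : Lam -> Lam -> R) (h : Lam -> R).
Hypothesis beta_sym : forall i j, beta i j = beta j i.
Hypothesis beta_ge0 : forall i j, 0 <= beta i j.
Hypothesis h_ge0 : forall i, 0 <= h i.
Hypothesis beta_connected : forall i j, connect (fun x y => 0 < beta x y) i j.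
Hypothesis h_neq0 : h <> (fun=> 0).

Lemma measurable_hamiltonian :
  measurable_fun setT (fun t => hamiltonian beta h (cfg t) : R).
Proof.
apply: measurable_funD; apply: measurable_funM => //; apply: measurable_sum => i.
  apply: measurable_sum => j; apply: measurable_funM => //; apply: measurable_sum => k.
  have -> : (fun t => (cfg t i - cfg t j) 0 k * (cfg t i - cfg t j) 0 k) =
      (fun t => (cfg t i 0 k - cfg t j 0 k) * (cfg t i 0 k - cfg t j 0 k)).
    by apply/funext => t; rewrite !mxE.
  by apply: measurable_funM; apply: measurable_funB; exact: measurable_config.
apply: measurable_funM => //; apply: measurable_sum => k.
by apply: measurable_funM; exact: measurable_config.
Qed.

Lemma measurable_weight : measurable_fun setT (fun t => expR (- hamiltonian beta h (cfg t))).
Proof.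
apply: measurableT_comp; first exact: measurable_expR.
by apply: measurable_funN; exact: measurable_hamiltonian.
Qed.

(** Coercivity bounds the weight by a Gaussian with constant e; half of e absorbs the polynomial and
    the other half remains for integrability. *)
Lemma integrable_poly_weight (F : U -> R) (C : R) (q : nat) :
  measurable_fun setT F ->
  (forall t, `|F t| <= C * (1 + \sum_j tnth t j ^+ 2) ^+ q) ->
  mu.-integrable setT (EFin \o (fun t => F t * expR (- hamiltonian beta h (cfg t)))).
Proof.
move=> mF FC.
have [e e0 he] := @hamiltonian_coercive R Lam n beta h beta_ge0 h_ge0 beta_connected h_neq0.
have e20 : 0 < e / 2 by rewrite divr_gt0.
have [D hD] := exp_dominates_poly q e20.
have Y0 t : 0 <= \sum_j tnth t j ^+ 2 by apply: sumr_ge0 => j _; exact: sqr_ge0.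
have C0 : 0 <= C.
  have := le_trans (normr_ge0 _) (FC [tuple 0 | _ < N]).
  by rewrite pmulr_lge0// exprn_gt0// ltr_pwDl.
apply: (@integrable_tuple_gaussian R N (e / 2) (C * D)) => //.
  by apply: measurable_funM => //; exact: measurable_weight.
move=> t; rewrite normrM (ger0_norm (expR_ge0 _)).
apply: le_trans (_ : C * (D * expR (e / 2 * \sum_j tnth t j ^+ 2)) *
   expR (- (e * \sum_j tnth t j ^+ 2)) <= _).
  apply: ler_pM => //; rewrite ?expR_ge0//.
    by apply: le_trans (FC t) _; rewrite ler_wpM2l// hD.
  by rewrite ler_expR lerN2 -sum_dot_config he.
rewrite -!mulrA -expRD le_eqVlt; apply/orP; left; apply/eqP.
by congr (_ * (_ * expR _)); field.
Qed.

Section tilted_mean.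
Variables (s : R) (K m : Lam -> R).
Hypothesis K_ge0 : forall i, 0 <= K i.
Hypothesis mP :
  forall j, \sum_l beta j l * (m j - m l) + (h j + K j) * m j = s * K j.

Local Notation tilted t := (expR (- tilted_hamiltonian beta h s K (cfg t))).

Let tiltedE t : tilted t = expR (- \sum_i K i * half_sq_norms (theta s (cfg t)) i) *
  expR (- hamiltonian beta h (cfg t)).
Proof. by rewrite -expRD -opprD addrC. Qed.

Let measurable_tilt :
  measurable_fun setT (fun t => expR (- \sum_i K i * half_sq_norms (theta s (cfg t)) i)).
Proof.
apply: measurableT_comp; first exact: measurable_expR.
apply: measurable_funN; apply: measurable_sum => i; apply: measurable_funM => //.
exact: measurable_half_sq_norms.
Qed.

Let tilt_le1 t : 0 <= expR (- \sum_i K i * half_sq_norms (theta s (cfg t)) i) <= 1.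
Proof.
rewrite expR_ge0 -[leRHS]expR0 ler_expR oppr_le0 sumr_ge0// => i _.
by rewrite mulr_ge0// half_sq_norms_ge0.
Qed.

Let Y t := \sum_j tnth t j ^+ 2.

Lemma config_le a t : `|cfg t a 0 ord0| <= 1 + Y t.
Proof.
have h1 : cfg t a 0 ord0 ^+ 2 <= Y t.
  rewrite /Y configE (bigD1 (enum_rank (a, ord0)))//= lerDl sumr_ge0// => j _.
  exact: sqr_ge0.
apply: le_trans (_ : 1 + cfg t a 0 ord0 ^+ 2 <= _); last by rewrite lerD2l.
rewrite -real_normK ?num_real//.
have := sqr_ge0 (`|cfg t a 0 ord0| - 1); have := normr_ge0 (cfg t a 0 ord0).
nra.
Qed.

Lemma integrable_tilted : mu.-integrable setT (EFin \o (fun t => tilted t)).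
Proof.
have := @integrable_poly_weight
  (fun t => expR (- \sum_i K i * half_sq_norms (theta s (cfg t)) i)) 1 0 measurable_tilt.
have b t : `|expR (- \sum_i K i * half_sq_norms (theta s (cfg t)) i)| <=
    1 * (1 + \sum_j tnth t j ^+ 2) ^+ 0.
  by have /andP[h1 h2] := tilt_le1 t; rewrite expr0 mulr1 ger0_norm.
by move=> /(_ b); apply: eq_integrable => // t _ /=; rewrite tiltedE.
Qed.

Lemma integrable_config_tilted a :
  mu.-integrable setT (EFin \o (fun t => cfg t a 0 ord0 * tilted t)).
Proof.
have := @integrable_poly_weight (fun t => cfg t a 0 ord0 *
  expR (- \sum_i K i * half_sq_norms (theta s (cfg t)) i)) 1 1
  (measurable_funM (measurable_config a ord0) measurable_tilt).
have b t : `|cfg t a 0 ord0 * expR (- \sum_i K i * half_sq_norms (theta s (cfg t)) i)| <=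
    1 * (1 + \sum_j tnth t j ^+ 2) ^+ 1.
  have /andP[h1 h2] := tilt_le1 t; rewrite expr1 mul1r normrM.
  rewrite (le_trans _ (config_le a t))// ler_piMr// ger0_norm//.
by move=> /(_ b); apply: eq_integrable => // t _ /=; rewrite tiltedE mulrA.
Qed.

(** The coordinates of twice the centre -m e^1, as a function on [nat] to fit
    [integral_tuple_measure_map]; 0 is the default beyond the last coordinate. *)
Let center (j : nat) : R :=
  if insub j is Some j' then
    - (2 * m (enum_val j' : Lam * 'I_n.+1).1) * @e1 R n 0 (enum_val (j' : 'I_N)).2 else 0.

Let flip t : U := [tuple center i - tnth t i | i < N].

Let config_flip t : cfg (flip t) = spin_reflection m (cfg t).
Proof.
apply/funext => i; apply/rowP => k; rewrite configE tnth_mktuple /center.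
rewrite valK enum_rankK /spin_reflection !mxE/= /of_tuple.
by rewrite mulNr addrC.
Qed.

Let integral_flip (f : U -> \bar R) : measurable_fun setT f -> (forall t, 0 <= f t)%E ->
  (\int[mu]_t f (flip t) = \int[mu]_t f t)%E.
Proof.
apply: (@integral_tuple_measure_map R N (fun i x => center i - x)).
- by move=> i; apply: measurable_funB => //; exact: measurable_id.
- by move=> i g; exact: integral_lebesgue_reflection.
Qed.

(** The flip exchanges the positive and negative parts, so their integrals agree; [fine] sends their
    difference to 0, whether they are finite or not. *)
Let odd_integral0 (f : U -> R) : measurable_fun setT f ->
  (forall t, f (flip t) = - f t) -> \int[mu]_t f t = 0.
Proof.
move=> mf fN; rewrite /Rintegral integralE.
have mf' : measurable_fun setT (EFin \o f) by exact/measurable_EFinP.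
have -> : (\int[mu]_x ((EFin \o f)^\- x) = \int[mu]_x ((EFin \o f)^\+ x))%E.
  rewrite -(integral_flip (measurable_funepos mf'))//.
  by apply: eq_integral => t _; rewrite funenegE funeposE/= fN.
by case: (\int[mu]_x _)%E => //= r; rewrite subrr.
Qed.

(* [spin_reflection m] preserves the tilted weight and flips the sign of u_a^1 + m_a. *)
Lemma tilted_mean a :
  \int[mu]_t ((cfg t a 0 ord0 + s) * tilted t) = (s - m a) * \int[mu]_t tilted t.
Proof.
have odd : \int[mu]_t ((cfg t a 0 ord0 + m a) * tilted t) = 0.
  apply: odd_integral0.
    apply: measurable_funM.
      by apply: measurable_funD => //; exact: measurable_config.
    by under eq_fun do rewrite tiltedE; apply: measurable_funM => //; exact: measurable_weight.
  move=> t; rewrite config_flip (tilted_hamiltonian_reflection beta_sym)// -mulNr.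
  by congr (_ * _); rewrite /spin_reflection !mxE/=; ring.
have i1 := integrable_tilted; have i2 := integrable_config_tilted a.
have cE (c : R) : \int[mu]_t ((cfg t a 0 ord0 + c) * tilted t) =
    \int[mu]_t (cfg t a 0 ord0 * tilted t) + c * \int[mu]_t tilted t.
  under eq_Rintegral do rewrite mulrDl.
  by rewrite RintegralD// ?RintegralZl//; exact: (integrableZl measurableT c i1).
by rewrite -[LHS]subr0 -odd !cE; ring.
Qed.

End tilted_mean.

End spin_integrals.

(** * The isomorphism *)

Section product_probability.
Context d1 d2 (T1 : measurableType d1) (T2 : measurableType d2) (R : realType).
Variables (m : {sigma_finite_measure set T1 -> \bar R}) (P : probability T2 R).

(** A name for the product that carries a sigma-finite structure, so that it can be the second
    factor of a further product. *)
Definition prod_prob : set (T1 * T2) -> \bar R := (m \x P)%E.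

HB.instance Definition _ := Measure.on prod_prob.

Let prod_prob_sigma_finite : sigma_finite setT prod_prob.
Proof.
have [F FT Foo] := sigma_finiteT m.
exists (fun k => F k `*` setT); first by rewrite -setX_bigcupl -FT setXTT.
move=> k; have [mF Fk] := Foo k; split; first exact: measurableX.
by rewrite /prod_prob product_measure1E//= probability_setT mule1.
Qed.

HB.instance Definition _ := Measure_isSigmaFinite.Build _ _ _ prod_prob
  prod_prob_sigma_finite.
End product_probability.

(** The integral is by definition a difference of integrals of nonnegative parts, each measurable by
    Tonelli. This covers parameters at which the inner integral fails to converge absolutely, which
    cannot be excluded for single spin configurations. *)
Lemma measurable_fubini_F_ereal d1 d2 (T1 : measurableType d1) (T2 : measurableType d2)
    (R : realType) (m2 : {sigma_finite_measure set T2 -> \bar R}) (f : T1 * T2 -> \bar R) :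
  measurable_fun setT f -> measurable_fun setT (fubini_F m2 f).
Proof.
move=> mf; rewrite (_ : fubini_F m2 f =
    (fun x => fubini_F m2 f^\+ x - fubini_F m2 f^\- x)%E); last first.
  apply/funext => x; rewrite /fubini_F [LHS]integralE.
  by congr (_ - _)%E; apply: eq_integral => y _; rewrite ?funeposE ?funenegE.
apply: emeasurable_funB.
- apply: measurable_fun_fubini_tonelli_F => //; exact: measurable_funepos.
- apply: measurable_fun_fubini_tonelli_F => //; exact: measurable_funeneg.
Qed.

Section walk_from_zero.
Context (R : realType) (Lam : finType) d (Om : measurableType d).
Variables (beta : Lam -> Lam -> R) (P : Lam -> probability Om R) (X : R -> Om -> Lam).
Hypothesis X_walk : random_walk beta P X.

(* Freezing the path before time 0 makes it measurable and right-continuous on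
   all of R, whereas the walk is unconstrained at negative times. *)
Definition extend_left : R -> Om -> Lam := fun r w => X (Num.max r 0) w.
Local Notation X' := extend_left.

Lemma extend_leftE r w : 0 <= r -> X' r w = X r w.
Proof. by move=> r0; rewrite /extend_left max_l. Qed.

Lemma measurable_extend_left t i : measurable [set w | X' t w = i].
Proof. by apply: (rw_measurable X_walk); rewrite le_max lexx orbT. Qed.

Lemma right_continuous_extend_left w t : \forall r \near t^'+, X' r w = X' t w.
Proof.
have [t0|t0] := leP 0 t.
  have := rw_right_continuous X_walk w t0; apply: filterS2 (nbhs_right_gt t) => r tr Xr.
  by rewrite !extend_leftE// (le_trans t0)// ltW.
near=> r; rewrite /extend_left !max_r// ltW//.
Unshelve. all: end_near. Qed.

Lemma markov_extend_left p i (s : seq (R * Lam)) :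
  (forall i (s : seq (R * Lam)), path <=%R 0 (unzip1 s) ->
    P i [set w | forall q, q \in s -> X q.1 w = q.2] = (path_prob p 0 i s)%:E) ->
  path <=%R 0 (unzip1 s) ->
  P i [set w | forall q, q \in s -> X' q.1 w = q.2] = (path_prob p 0 i s)%:E.
Proof.
move=> hX hs; rewrite -hX//; congr (P i _).
have /allP h0 := order_path_min le_trans hs.
have E q w : q \in s -> X' q.1 w = X q.1 w.
  by move=> qs; rewrite extend_leftE// h0//; exact: map_f.
by apply/seteqP; split => w /= h q qs; [rewrite -E//|rewrite E//]; exact: h.
Qed.

Lemma local_timeE (l : Lam -> R) t w i : local_time X l t w i =
  l i + occupation X' (fun j => (j == i)%:R) 0 t w.
Proof.
congr (_ + _); apply: eq_Rintegral => r; rewrite inE/= in_itv/= => /andP[r0 _].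
by rewrite extend_leftE.
Qed.

End walk_from_zero.

Section isomorphism.
Context (R : realType) (Lam : finType) (n : nat).
Local Notation mR := (measurableTypeR R).
Local Notation leb := (@lebesgue_measure R).
Local Notation N := #|{: Lam * 'I_n.+1}|.
Local Notation U := (N.-tuple mR).
Local Notation T := (#|Lam|.-tuple mR).
Local Notation mu := (tuple_measure leb N).
Local Notation cfg t := (config (t : N.-tuple R)).
Variables (beta : Lam -> Lam -> R) (h : Lam -> R).
Hypothesis beta_sym : forall i j, beta i j = beta j i.
Hypothesis beta_ge0 : forall i j, 0 <= beta i j.
Hypothesis beta_connected : forall i j, connect (fun x y => 0 < beta x y) i j.
Hypothesis h_ge0 : forall i, 0 <= h i.
Hypothesis h_neq0 : h <> (fun=> 0).
Context d (Om : measurableType d).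
Variables (P : Lam -> probability Om R) (X0 : R -> Om -> Lam).
Hypothesis X_walk : random_walk beta P X0.
Variables (a : Lam) (s : R).

Local Notation X := (extend_left X0).
Let mX := measurable_extend_left X_walk.
Let rcX := right_continuous_extend_left X_walk.
Local Notation weight t := (expR (- hamiltonian beta h (cfg t))).

Local Notation mV i := (prod_prob leb (P i)).
Local Notation mW i := (mu \x (prod_prob leb (P i)))%E.

Definition to_tuple (l : Lam -> R) : T := [tuple l (enum_val i) | i < #|Lam|].

Lemma to_tupleK l : of_tuple (to_tuple l) = l.
Proof. by apply/funext => i; rewrite /of_tuple tnth_mktuple enum_rankK. Qed.

Lemma measurable_to_tuple d' (Y : measurableType d') (l : Y -> Lam -> R) :
  (forall i, measurable_fun setT (fun y => l y i : R)) ->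
  measurable_fun setT (fun y => to_tuple (l y)).
Proof.
move=> ml; apply/measurable_fun_tnthP => i.
rewrite (_ : _ \o _ = fun y => l y (enum_val i)); first exact: ml.
by apply/funext => y /=; rewrite tnth_mktuple.
Qed.

Let ell (t : U) (i : Lam) : R := half_sq_norms (theta s (cfg t)) i.
Let lam (v : mR * Om) (i : Lam) : R := occupation X (fun j => (j == i)%:R) 0 v.1 v.2.

Let lam_ge0 v i : 0 <= lam v i. Proof. exact: occupation_ge0. Qed.
Let ell_ge0 t i : 0 <= ell t i. Proof. exact: half_sq_norms_ge0. Qed.

Let measurable_lam i : measurable_fun setT (fun v => lam v i).
Proof. exact: measurable_occupation. Qed.

Let measurable_ell i : measurable_fun setT (fun t => ell t i).
Proof. exact: measurable_half_sq_norms. Qed.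

(** [Phi0] and [Phi1] are the arguments of g on the left-hand and right-hand sides: the initial
    local times, and those accumulated by the walk on top of them. The densities that go with them
    are [rho0] and [rho1]. *)
Let Phi0 (t : U) : T := to_tuple (ell t).
Let Phi1 (z : U * (mR * Om)) : T := to_tuple (fun i => ell z.1 i + lam z.2 i).

Let mPhi0 : measurable_fun setT Phi0.
Proof. exact: measurable_to_tuple. Qed.

Let mPhi1 : measurable_fun setT Phi1.
Proof.
apply: measurable_to_tuple => i; apply: measurable_funD.
  exact: (measurableT_comp (measurable_ell i)).
exact: (measurableT_comp (measurable_lam i)).
Qed.

Let orthant_Phi0 t : orthant (Phi0 t).
Proof. by move=> i; rewrite tnth_mktuple. Qed.

Let orthant_Phi1 z : orthant (Phi1 z).
Proof. by move=> i; rewrite tnth_mktuple addr_ge0. Qed.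

Let measurable_nonneg_time :
  measurable_fun setT (fun v : mR * Om => (0 <= v.1)%R%:R : R).
Proof.
rewrite (_ : (fun _ => _) = \1_([set v : mR * Om | 0 <= v.1])).
  apply: measurable_indic; rewrite -[X in measurable X]setTI.
  by apply: measurable_fun_ler.
by apply/funext => v; rewrite indicE; congr (nat_of_bool _)%:R; apply/idP/idP; rewrite inE.
Qed.

(* Vanishes at negative times, so that time can be integrated over all of R. *)
Let kill (v : mR * Om) : R :=
  (0 <= v.1)%R%:R * ((X v.1 v.2 == a)%:R * expR (- \sum_j h j * lam v j)).

Let kill_ge0 v : 0 <= kill v.
Proof. by rewrite !mulr_ge0// expR_ge0. Qed.

Let measurable_kill : measurable_fun setT kill.
Proof.
apply: measurable_funM; first exact: measurable_nonneg_time.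
apply: measurable_funM; first exact: (measurable_state_pair mX rcX (fun j => (j == a)%:R)).
apply: measurableT_comp; first exact: measurable_expR.
by apply: measurable_funN; apply: measurable_sum => j; exact: measurable_funM.
Qed.

Let rho0 (t : U) : R := (cfg t a 0 ord0 + s) * weight t.
Let rho1 (z : U * (mR * Om)) : R := kill z.2 * weight z.1.

Let mrho0 : measurable_fun setT rho0.
Proof.
apply: measurable_funM; last exact: measurable_weight.
by apply: measurable_funD => //; exact: measurable_config.
Qed.

Let mrho1 : measurable_fun setT rho1.
Proof.
apply: measurable_funM; first exact: (measurableT_comp measurable_kill).
exact: (measurableT_comp (measurable_weight _ _)).
Qed.

Let rho1_ge0 z : 0 <= rho1 z. Proof. by rewrite mulr_ge0// expR_ge0. Qed.

Section exponential_test.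
Variable K : Lam -> R.
Hypothesis K_ge1 : forall i, 1 <= K i.

Let kappa i := h i + K i.
Let kappa_ge1 i : 1 <= kappa i. Proof. by rewrite ler_wpDl. Qed.

Local Notation tilted t := (expR (- tilted_hamiltonian beta h s K (cfg t))).

(** An exponential test function splits over the sum of initial and accumulated local time: the
    first part tilts the spin weight, the second adds K to the killing rate h. The integrand thus
    becomes a product of a function of the spins and a function of time and path. *)
Let laplace1 z : rho1 z * expR (- \sum_i K i * (ell z.1 i + lam z.2 i)) =
  tilted z.1 * ((0 <= z.2.1)%R%:R * survival X kappa z.2.1 a z.2.2).
Proof.
rewrite /rho1 /kill /survival (occupation_sum mX rcX).
have -> : \sum_i K i * (ell z.1 i + lam z.2 i) =
    \sum_i K i * ell z.1 i + \sum_i K i * lam z.2 i.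
  by rewrite -big_split/=; apply: eq_bigr => i _; rewrite mulrDr.
have -> : \sum_j kappa j * occupation X (fun i => (i == j)%:R) 0 z.2.1 z.2.2 =
    \sum_i h i * lam z.2 i + \sum_i K i * lam z.2 i.
  by rewrite -big_split/=; apply: eq_bigr => i _; rewrite mulrDl.
rewrite /tilted_hamiltonian -/(ell z.1) !opprD !expRD; ring.
Qed.

Let kill_integral i :
  (\int[mV i]_v ((0 <= v.1)%R%:R * survival X kappa v.1 a v.2)%:E)%E =
  (killed_resolvent X P kappa i a)%:E.
Proof.
pose f (v : mR * Om) := ((0 <= v.1)%R%:R * survival X kappa v.1 a v.2)%:E.
have mf : measurable_fun setT f.
  apply/measurable_EFinP; apply: measurable_funM; first exact: measurable_nonneg_time.
  exact: (measurable_survival_pair mX rcX).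
have f0 v : (0 <= f v)%E by rewrite lee_fin mulr_ge0// survival_ge0.
have [p tp mp] := rw_markov X_walk.
rewrite /prod_prob (fubini_tonelli1 f mf f0) -(killed_resolventE mX rcX P kappa_ge1 i a).
rewrite [RHS]integral_mkcond; apply: eq_integral => r _.
rewrite /fubini_F /f /patch mem_setE in_itv/= andbT; case: ifP => r0.
  under eq_integral do rewrite mul1r.
  rewrite /killed_semigroup /Rintegral fineK//.
  apply: integrable_fin_num => //.
  apply: (@probability_bounded_integrable _ _ _ _ _ 1).
    exact: (measurable_survival mX rcX).
  by move=> w; rewrite ger0_norm ?survival_ge0 ?survival_le1.
by apply: integral0_eq => w _; rewrite mul0r.
Qed.

Lemma laplace_rho1 i :
  (mW i).-integrable setT
    (EFin \o (fun z => rho1 z * expR (- \sum_i K i * (ell z.1 i + lam z.2 i)))) /\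
  \int[mW i]_z (rho1 z * expR (- \sum_i K i * (ell z.1 i + lam z.2 i))) =
  killed_resolvent X P kappa i a * \int[mu]_t tilted t.
Proof.
pose f (z : U * (mR * Om)) : R := rho1 z * expR (- \sum_i K i * (ell z.1 i + lam z.2 i)).
pose k (v : mR * Om) : R := (0 <= v.1)%R%:R * survival X kappa v.1 a v.2.
have mf : measurable_fun setT f.
  apply: measurable_funM => //; apply: measurableT_comp; first exact: measurable_expR.
  apply: measurable_funN; apply: measurable_sum => j; apply: measurable_funM => //.
  apply: measurable_funD; first exact: (measurableT_comp (measurable_ell j)).
  exact: (measurableT_comp (measurable_lam j)).
have f0 z : 0 <= f z by rewrite mulr_ge0// expR_ge0.
have k0 v : 0 <= k v by rewrite mulr_ge0// survival_ge0.
have mk : measurable_fun setT k.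
  apply: measurable_funM; first exact: measurable_nonneg_time.
  exact: (measurable_survival_pair mX rcX).
have it := @integrable_tilted R Lam n beta h beta_ge0 h_ge0 beta_connected h_neq0 s K
  (fun i => le_trans ler01 (K_ge1 i)).
have fE : (\int[mW i]_z (f z)%:E)%E =
    (killed_resolvent X P kappa i a * \int[mu]_t tilted t)%:E.
  have mf' : measurable_fun setT (EFin \o f) by exact/measurable_EFinP.
  rewrite (fubini_tonelli1 (EFin \o f) mf'); last by move=> z; rewrite lee_fin.
  rewrite EFinM -kill_integral [in RHS]/Rintegral fineK; last exact: integrable_fin_num.
  have k_ge0 : (0 <= \int[mV i]_v (k v)%:E)%E by apply: integral_ge0 => v _; rewrite lee_fin.
  have mt : measurable_fun setT (fun t : U => (tilted t)%:E).
    by case/integrableP: it.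
  have mk' : measurable_fun setT (fun v => (k v)%:E) by exact/measurable_EFinP.
  have t0 t : (0 <= (tilted t)%:E)%E by rewrite lee_fin expR_ge0.
  rewrite -ge0_integralZl//.
  apply: eq_integral => t _.
  transitivity (\int[mV i]_v ((tilted t)%:E * (k v)%:E))%E.
    by apply: eq_integral => v _; rewrite /f/= (laplace1 (t, v)).
  by rewrite ge0_integralZl//= 1?muleC// => v _; rewrite lee_fin.
split; last by rewrite /Rintegral -/f fE.
apply/integrableP; split; first exact/measurable_EFinP.
under eq_integral do rewrite /= ger0_norm ?f0//.
by rewrite fE ltry.
Qed.

Lemma laplace_rho0 :
  mu.-integrable setT
    (EFin \o (fun t => rho0 t * expR (- \sum_i K i * ell t i))) /\
  \int[mu]_t (rho0 t * expR (- \sum_i K i * ell t i)) =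
  s * (\sum_i h i * killed_resolvent X P kappa i a) * \int[mu]_t tilted t.
Proof.
have [p tp mp] := rw_markov X_walk.
have K_ge0 i : 0 <= K i := le_trans ler01 (K_ge1 i).
pose G := killed_resolvent X P kappa.
pose m j := s - s * \sum_i h i * G i j.
have GP i j := killed_resolvent_inverse mX rcX tp
  (fun i s => @markov_extend_left R Lam d Om P X0 p i s mp) kappa_ge1 beta_sym i j.
(* Applying h + K - Delta_beta to the constant s gives s (h + K), and applying it to s h G gives s
   h, by the inverse property of G; the difference is s K. *)
have mP j : \sum_l beta j l * (m j - m l) + (h j + K j) * m j = s * K j.
  have -> : \sum_l beta j l * (m j - m l) =
      - s * \sum_i h i * \sum_l beta j l * (G i j - G i l).
    rewrite mulr_sumr; under [RHS]eq_bigr do rewrite !mulr_sumr.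
    rewrite exchange_big/=; apply: eq_bigr => l _.
    rewrite /m opprD addrACA subrr add0r opprK -mulrN -mulrDr -sumrN -big_split/=.
    rewrite !mulr_sumr; apply: eq_bigr => i _; ring.
  rewrite /m mulrBr mulrCA [X in _ + (_ - s * X)]mulr_sumr.
  have -> : \sum_i h i * \sum_l beta j l * (G i j - G i l) =
      h j - \sum_i (h j + K j) * (h i * G i j).
    rewrite [X in X - _](_ : h j = \sum_i h i * (i == j)%:R); last first.
      by rewrite (bigD1 j)//= eqxx mulr1 big1 ?addr0// => i /negbTE ->; rewrite mulr0.
    rewrite -sumrB; apply: eq_bigr => i _; rewrite -(GP i j) /G /kappa; ring.
  ring.
have it := @integrable_tilted R Lam n beta h beta_ge0 h_ge0 beta_connected h_neq0 s K K_ge0.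
have ia := @integrable_config_tilted R Lam n beta h beta_ge0 h_ge0 beta_connected
  h_neq0 s K K_ge0 a.
have E t : rho0 t * expR (- \sum_i K i * ell t i) = (cfg t a 0 ord0 + s) * tilted t.
  by rewrite /rho0 -mulrA -expRD -opprD.
split.
  have := integrableD measurableT ia (integrableZl measurableT s it).
  by apply: eq_integrable => // t _ /=; rewrite E mulrDl.
under eq_Rintegral do rewrite E.
rewrite (@tilted_mean R Lam n beta h beta_sym beta_ge0 h_ge0 beta_connected h_neq0 s K m K_ge0 mP).
by rewrite /m; congr (_ * _); ring.
Qed.

End exponential_test.

(** Bridges two ranges of exponents: uniqueness of Laplace transforms asks for every e >= 0, the
    exponential identity for K >= 1. Multiplying by [W] replaces e by K = 1 + e. *)
Let W (x : T) : R := expR (- \sum_j tnth x j).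

Let measurable_sum_tnth : measurable_fun setT (fun x : T => \sum_j tnth x j : R).
Proof. by apply: measurable_sum => j; exact: (@measurable_tnth _ mR). Qed.

Let measurable_W : measurable_fun setT W.
Proof.
apply: measurableT_comp; first exact: measurable_expR.
exact: measurable_funN.
Qed.

Let sum_to_tuple (e : 'I_#|Lam| -> R) (l : Lam -> R) :
  \sum_j e j * tnth (to_tuple l) j = \sum_i e (enum_rank i) * l i.
Proof.
rewrite (reindex (@enum_rank Lam))/=; last first.
  by exists enum_val => x _; rewrite ?enum_rankK ?enum_valK.
by apply: eq_bigr => i _; rewrite tnth_mktuple enum_rankK.
Qed.

Let W_exp_test e l : W (to_tuple l) * exp_test e (to_tuple l) =
  expR (- \sum_i (1 + e (enum_rank i)) * l i).
Proof.
rewrite /W /exp_test -expRD -opprD.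
under eq_bigr do rewrite -[tnth _ _]mul1r.
rewrite (sum_to_tuple (fun=> 1)) sum_to_tuple -big_split/=.
by congr (expR (- _)); apply: eq_bigr => i _; rewrite mulrDl.
Qed.

Let W_to_tuple l : W (to_tuple l) = expR (- \sum_i 1 * l i).
Proof.
by rewrite /W; under eq_bigr do rewrite -[tnth _ _]mul1r; rewrite (sum_to_tuple (fun=> 1)).
Qed.

Let wrho0 t := rho0 t * W (Phi0 t).
Let wrho1 z := rho1 z * W (Phi1 z).

Let integrable_wrho0 : mu.-integrable setT (EFin \o wrho0).
Proof.
have [h1 _] := laplace_rho0 (K := fun=> 1) (fun=> lexx 1).
by apply: eq_integrable h1 => // t _ /=; rewrite /wrho0 W_to_tuple.
Qed.

Let integrable_wrho1 i : (mW i).-integrable setT (EFin \o wrho1).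
Proof.
have [h1 _] := laplace_rho1 (K := fun=> 1) (fun=> lexx 1) i.
by apply: eq_integrable h1 => // z _ /=; rewrite /wrho1 W_to_tuple.
Qed.

Let defect (F : T -> R) : R :=
  - s * (\sum_i h i * \int[mW i]_z (wrho1 z * F (Phi1 z))) +
  \int[mu]_t (wrho0 t * F (Phi0 t)).

Let normal_defect : normal_functional defect.
Proof.
apply: normal_functional_lin.
  apply: normal_functional_sum => i.
  exact: (normal_functional_integral (integrable_wrho1 i) mPhi1 orthant_Phi1).
exact: (normal_functional_integral integrable_wrho0 mPhi0 orthant_Phi0).
Qed.

Let defect0 (F : T -> R) : orthant_bounded F -> defect F = 0.
Proof.
apply: normal_functional0 => // e e0.
pose K i := 1 + e (enum_rank i).
have K_ge1 i : 1 <= K i by rewrite lerDl.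
rewrite /defect.
have -> : \int[mu]_t (wrho0 t * exp_test e (Phi0 t)) =
    \int[mu]_t (rho0 t * expR (- \sum_i K i * ell t i)).
  by apply: eq_Rintegral => t _; rewrite /wrho0 -mulrA W_exp_test.
have E i : \int[mW i]_z (wrho1 z * exp_test e (Phi1 z)) =
    \int[mW i]_z (rho1 z * expR (- \sum_i K i * (ell z.1 i + lam z.2 i))).
  by apply: eq_Rintegral => z _; rewrite /wrho1 -mulrA W_exp_test.
under eq_bigr do rewrite E (laplace_rho1 K_ge1 _).2 mulrA.
by rewrite (laplace_rho0 K_ge1).2 -mulr_suml mulrA mulNr mulNr addNr.
Qed.

(** * From bounded functions to moderate growth *)

Section growth.
Variables (gT : T -> R) (C : R) (q : nat).
Hypothesis mgT : measurable_fun setT gT.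
Hypothesis gT_growth : forall l : Lam -> R,
  `|gT (to_tuple l)| <= C * (1 + Num.sqrt (\sum_i l i ^+ 2)) ^+ q.

(* On [cut k] the product of gT with the inverse of the weight W is bounded by k. *)
Definition cut k : set T := [set x | `|gT x| * expR (\sum_j tnth x j) <= k%:R].

Lemma measurable_cut k : measurable (cut k).
Proof.
rewrite -[X in measurable X]setTI; apply: measurable_fun_ler => //.
apply: measurable_funM; first exact: measurableT_comp.
by apply: measurableT_comp; first exact: measurable_expR.
Qed.

Lemma indic_cut_near x : \forall k \near \oo, \1_(cut k) x = 1 :> R.
Proof.
near=> k; rewrite indicE mem_set//= /cut/=.
near: k; exact: nbhs_infty_ger.
Unshelve. all: by end_near. Qed.

Lemma cut_identity k :
  \int[mu]_t (rho0 t * (gT (Phi0 t) * \1_(cut k) (Phi0 t))) =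
  s * \sum_i h i * \int[mW i]_z (rho1 z * (gT (Phi1 z) * \1_(cut k) (Phi1 z))).
Proof.
pose F x : R := gT x * expR (\sum_j tnth x j) * \1_(cut k) x.
have bF : orthant_bounded F.
  split.
    apply: measurable_funM; last by apply: measurable_indic; exact: measurable_cut.
    by apply: measurable_funM => //; apply: measurableT_comp; first exact: measurable_expR.
  exists k%:R => x _; rewrite /F indicE.
  have [|] := boolP (x \in cut k); last by rewrite mulr0 normr0.
  by rewrite inE/= mulr1 normrM (ger0_norm (expR_ge0 _)).
have WF x : W x * F x = gT x * \1_(cut k) x.
  by rewrite /W /F mulrA mulrCA -expRD addNr expR0 mulr1.
have := defect0 bF; rewrite /defect => /eqP; rewrite addrC mulNr subr_eq0 => /eqP.
have -> : \int[mu]_t (wrho0 t * F (Phi0 t)) =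
    \int[mu]_t (rho0 t * (gT (Phi0 t) * \1_(cut k) (Phi0 t))).
  by apply: eq_Rintegral => t _; rewrite /wrho0 -mulrA WF.
move=> ->; congr (_ * _); apply: eq_bigr => i _; congr (_ * _).
by apply: eq_Rintegral => z _; rewrite /wrho1 -mulrA WF.
Qed.

Lemma integrable_cut i k :
  (mW i).-integrable setT (EFin \o (fun z => rho1 z * (gT (Phi1 z) * \1_(cut k) (Phi1 z)))).
Proof.
have := integrableZl measurableT k%:R (integrable_wrho1 i).
apply: le_integrable => //.
  apply/measurable_EFinP; apply: measurable_funM => //; apply: measurable_funM.
    exact: measurableT_comp.
  by apply: (measurableT_comp _ mPhi1); apply: measurable_indic; exact: measurable_cut.
move=> z _ /=; rewrite lee_fin /wrho1; move: (rho1 z) (rho1_ge0 z) => r r0.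
rewrite !normrM !(ger0_norm r0) normr_nat.
rewrite [leRHS]mulrCA ler_wpM2l// (ger0_norm (expR_ge0 _)).
have [|] := boolP (Phi1 z \in cut k).
  rewrite inE/= /cut/= mulr1 => h1.
  by rewrite /W expRN ler_pdivlMr ?expR_gt0// (le_trans h1)// ler_norm.
by rewrite mulr0 mulr_ge0.
Qed.

Let Y (t : U) := \sum_j tnth t j ^+ 2.

Lemma integrable_rho0_growth : mu.-integrable setT (EFin \o (fun t => rho0 t * gT (Phi0 t))).
Proof.
(* Chosen so that both |u_a^1 + s| and 1 + |ell| are at most D (1 + |u|^2), whence the power q + 1
   below; the term s^2 |Lambda| sums the shifts in [half_sq_norms_le] over the sites. *)
pose D := 1 + `|s| + s ^+ 2 *+ #|Lam|.
have D0 : 0 <= D by rewrite !addr_ge0// mulrn_wge0// sqr_ge0.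
have Y0 t : 0 <= Y t by apply: sumr_ge0 => j _; exact: sqr_ge0.
have C0 : 0 <= C.
  have := le_trans (normr_ge0 _) (gT_growth (fun=> 0)).
  by rewrite pmulr_lge0// exprn_gt0// ltr_pwDl// sqrtr_ge0.
have e1 t : `|cfg t a 0 ord0 + s| <= D * (1 + Y t).
  apply: le_trans (ler_normD _ _) _.
  have := @config_le R Lam n a t; rewrite -/(Y t) => h1.
  have h2 : 0 <= s ^+ 2 *+ #|Lam| by rewrite mulrn_wge0// sqr_ge0.
  have h3 := normr_ge0 s; have h4 := Y0 t.
  rewrite /D; nra.
have e2 t : 1 + Num.sqrt (\sum_i ell t i ^+ 2) <= D * (1 + Y t).
  have h1 : Num.sqrt (\sum_i ell t i ^+ 2) <= \sum_i ell t i.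
    have S0 : 0 <= \sum_i ell t i by apply: sumr_ge0 => i _; exact: ell_ge0.
    rewrite -[leRHS]ger0_norm// -sqrtr_sqr ler_sqrt ?sqr_ge0// expr2 mulr_suml.
    apply: ler_sum => i _; rewrite expr2 ler_wpM2l// (bigD1 i)//= lerDl.
    by apply: sumr_ge0 => j _; exact: ell_ge0.
  have h2 : \sum_i ell t i <= Y t + s ^+ 2 *+ #|Lam|.
    rewrite -sumr_const /Y -sum_dot_config -big_split/=.
    by apply: ler_sum => i _; exact: half_sq_norms_le.
  have h3 : 0 <= s ^+ 2 *+ #|Lam| by rewrite mulrn_wge0// sqr_ge0.
  have h4 := normr_ge0 s; have h5 := Y0 t.
  rewrite /D; nra.
have := @integrable_poly_weight R Lam n beta h beta_ge0 h_ge0 beta_connected h_neq0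
  (fun t => (cfg t a 0 ord0 + s) * gT (Phi0 t)) (C * D ^+ q.+1) q.+1.
move=> /(_ _ _) hi; have : mu.-integrable setT (EFin \o (fun t =>
    (cfg t a 0 ord0 + s) * gT (Phi0 t) * weight t)).
  apply: hi.
    apply: measurable_funM; last exact: measurableT_comp.
    by apply: measurable_funD => //; exact: measurable_config.
  move=> t; rewrite normrM -/(Y t).
  apply: le_trans (_ : (D * (1 + Y t)) * (C * (D * (1 + Y t)) ^+ q) <= _).
    apply: ler_pM => //; apply: le_trans (gT_growth _) _; rewrite ler_wpM2l//.
    by rewrite lerXn2r// nnegrE ?mulr_ge0// ?addr_ge0// sqrtr_ge0.
  by rewrite mulrCA -exprS exprMn mulrA.
by apply: eq_integrable => // t _ /=; rewrite /rho0 mulrAC.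
Qed.

End growth.

Section growth_identity.
Variables (gT : T -> R) (C : R) (q : nat).
Hypothesis mgT : measurable_fun setT gT.
Hypothesis gT_growth : forall l : Lam -> R,
  `|gT (to_tuple l)| <= C * (1 + Num.sqrt (\sum_i l i ^+ 2)) ^+ q.

(** For |g| all summands on the right are nonnegative, so each is bounded by the whole sum, and
    dividing by |s| h_i isolates the i-th. The bound does not depend on the truncation level; since
    the cut sets increase to the whole space, monotone convergence concludes. *)
Lemma integrable_rho1_growth i : s != 0 -> 0 < h i ->
  (mW i).-integrable setT (EFin \o (fun z => rho1 z * gT (Phi1 z))).
Proof.
move=> s0 hi.
pose ag x := `|gT x|.
have mag : measurable_fun setT ag by exact: measurableT_comp.
have ag_growth l : `|ag (to_tuple l)| <= C * (1 + Num.sqrt (\sum_i l i ^+ 2)) ^+ q.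
  by rewrite /ag normr_id.
pose J j k := \int[mW j]_z (rho1 z * (ag (Phi1 z) * \1_(cut ag k) (Phi1 z))).
have J0 j k : 0 <= J j k.
  by apply: Rintegral_ge0 => z _; rewrite mulr_ge0// mulr_ge0 ?normr_ge0// indicE ler0n.
pose M := \int[mu]_t `|rho0 t * ag (Phi0 t)|.
have iag := integrable_rho0_growth mag ag_growth.
have JM k : J i k <= M / (`|s| * h i).
  rewrite ler_pdivlMr ?mulr_gt0 ?normr_gt0//.
  have -> : J i k * (`|s| * h i) = `|s| * (h i * J i k) by ring.
  apply: le_trans (_ : `|s| * (\sum_j h j * J j k) <= _).
    rewrite ler_wpM2l// (bigD1 i)//= lerDl sumr_ge0// => j _.
    by rewrite mulr_ge0.
  rewrite -[X in _ * X]ger0_norm; last by apply: sumr_ge0 => j _; rewrite mulr_ge0.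
  rewrite -normrM -(cut_identity mag k).
  have mc : measurable_fun setT (fun t => rho0 t * (ag (Phi0 t) * \1_(cut ag k) (Phi0 t))).
    apply: measurable_funM => //; apply: measurable_funM; first exact: measurableT_comp.
    by apply: (measurableT_comp _ mPhi0); apply: measurable_indic; exact: measurable_cut.
  have b t : `|rho0 t * (ag (Phi0 t) * \1_(cut ag k) (Phi0 t))| <= `|rho0 t * ag (Phi0 t)|.
    rewrite mulrA normrM ler_piMr// indicE; case: (_ \in _); rewrite /= ?normr1 ?normr0//.
  have ic : mu.-integrable setT
      (EFin \o (fun t => rho0 t * (ag (Phi0 t) * \1_(cut ag k) (Phi0 t)))).
    apply: le_integrable (iag) => //; first exact/measurable_EFinP.
    by move=> t _ /=; rewrite lee_fin.
  apply: le_trans (le_normr_Rintegral _ ic) _ => //.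
  apply: le_Rintegral => //.
  - exact: (integrable_norm ic).
  - exact: (integrable_norm iag).
have m1 : measurable_fun setT (fun z => rho1 z * gT (Phi1 z)).
  by apply: measurable_funM => //; exact: measurableT_comp.
apply/integrableP; split; first exact/measurable_EFinP.
pose F k : set (U * (mR * Om)) := Phi1 @^-1` cut ag k.
have mF k : measurable (F k).
  rewrite -[F k]setTI; apply: mPhi1 => //; exact: measurable_cut.
have FT : \bigcup_k F k = setT.
  apply/seteqP; split => // z _.
  have [k _ hk] := indic_cut_near ag (Phi1 z).
  exists k => //=; apply: contrapT => nF.
  have := hk k (leqnn k); rewrite /= indicE memNset//= => /eqP.
  by rewrite eq_sym oner_eq0.
have mabs : measurable_fun setT (fun z => (rho1 z * ag (Phi1 z))%:E).
  apply/measurable_EFinP; apply: measurable_funM => //; exact: measurableT_comp.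
have absE z : (`|(rho1 z * gT (Phi1 z))%:E| = (rho1 z * ag (Phi1 z))%:E)%E.
  by rewrite /= normrM (ger0_norm (rho1_ge0 z)).
under eq_integral do rewrite [X in abse X]/= absE.
have cv : (\int[mW i]_(z in F k) (rho1 z * ag (Phi1 z))%:E)%E @[k --> \oo] -->
    (\int[mW i]_(z in setT) (rho1 z * ag (Phi1 z))%:E)%E.
  rewrite -FT; apply: ge0_nondecreasing_set_cvg_integral => //.
  - move=> k k' kk'; apply/subsetPset => z /=; rewrite /F/= /cut/= => hk.
    by rewrite (le_trans hk)// ler_nat.
  - by move=> k; exact: measurable_funTS.
  - by move=> k z _; rewrite lee_fin mulr_ge0// normr_ge0.
apply: (@le_lt_trans _ _ (M / (`|s| * h i))%:E); last exact: ltry.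
rewrite -(cvg_lim _ cv)//; apply: lime_le.
  by apply/cvg_ex; eexists; exact: cv.
near=> k; rewrite integral_mkcond.
have -> : (\int[mW i]_x ((fun z => (rho1 z * ag (Phi1 z))%:E) \_ (F k)) x)%E = (J i k)%:E.
  rewrite /J /Rintegral fineK; last first.
    by apply: integrable_fin_num => //; exact: integrable_cut.
  apply: eq_integral => z _; rewrite /patch indicE.
  have -> : (z \in F k) = (Phi1 z \in cut ag k) by apply/idP/idP; rewrite !inE.
  by case: ifP => _; rewrite ?mulr1 ?mulr0.
by rewrite lee_fin.
Unshelve. all: by end_near. Qed.

Lemma growth_identity :
  \int[mu]_t (rho0 t * gT (Phi0 t)) =
  s * \sum_i h i * \int[mW i]_z (rho1 z * gT (Phi1 z)).
Proof.
have lim0 : \int[mu]_t (rho0 t * (gT (Phi0 t) * \1_(cut gT k) (Phi0 t))) @[k --> \oo] -->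
    \int[mu]_t (rho0 t * gT (Phi0 t)).
  have i0 := integrable_rho0_growth mgT gT_growth.
  have [] // := @Rintegral_dominated_cvg _ _ _ mu setT
    (fun k t => rho0 t * (gT (Phi0 t) * \1_(cut gT k) (Phi0 t)))
    (fun t => rho0 t * gT (Phi0 t)) (fun t => `|rho0 t * gT (Phi0 t)|) measurableT.
  - move=> k; apply: measurable_funM => //; apply: measurable_funM; first exact: measurableT_comp.
    by apply: (measurableT_comp _ mPhi0); apply: measurable_indic; exact: measurable_cut.
  - by apply: measurable_funM => //; exact: measurableT_comp.
  - apply: aeW => t _; apply: cvg_near_cst.
    by apply: filterS (indic_cut_near gT (Phi0 t)) => k ->; rewrite mulr1.
  - exact: (integrable_norm i0).
  - move=> k t _; rewrite mulrA normrM ler_piMr// indicE.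
    by case: (_ \in _); rewrite /= ?normr1 ?normr0.
have lim1 : s * (\sum_i h i * \int[mW i]_z (rho1 z * (gT (Phi1 z) * \1_(cut gT k) (Phi1 z))))
    @[k --> \oo] --> s * (\sum_i h i * \int[mW i]_z (rho1 z * gT (Phi1 z))).
  (* Integrability of the right-hand integrands is available only for s != 0 and h_i > 0; in the
     remaining cases the terms are 0 along the sequence and in the limit. *)
  have [->|s0] := eqVneq s 0.
    under eq_fun do rewrite mul0r; rewrite mul0r; exact: cvg_cst.
  apply: cvgM; first exact: cvg_cst.
  apply: cvgr_sum => i _.
  have := h_ge0 i; rewrite le_eqVlt => /predU1P[<-|hi].
    under eq_fun do rewrite mul0r; rewrite mul0r; exact: cvg_cst.
  apply: cvgM; first exact: cvg_cst.
  have i1 := integrable_rho1_growth s0 hi.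
  have [] // := @Rintegral_dominated_cvg _ _ _ (mW i) setT
    (fun k z => rho1 z * (gT (Phi1 z) * \1_(cut gT k) (Phi1 z)))
    (fun z => rho1 z * gT (Phi1 z)) (fun z => `|rho1 z * gT (Phi1 z)|) measurableT.
  - move=> k; apply: measurable_funM => //; apply: measurable_funM; first exact: measurableT_comp.
    by apply: (measurableT_comp _ mPhi1); apply: measurable_indic; exact: measurable_cut.
  - by apply: measurable_funM => //; exact: measurableT_comp.
  - apply: aeW => z _; apply: cvg_near_cst.
    by apply: filterS (indic_cut_near gT (Phi1 z)) => k ->; rewrite mulr1.
  - exact: (integrable_norm i1).
  - move=> k z _; rewrite mulrA normrM ler_piMr// indicE.
    by case: (_ \in _); rewrite /= ?normr1 ?normr0.
have E : (fun k => s * (\sum_i h i *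
      \int[mW i]_z (rho1 z * (gT (Phi1 z) * \1_(cut gT k) (Phi1 z)))))
    = (fun k => \int[mu]_t (rho0 t * (gT (Phi0 t) * \1_(cut gT k) (Phi0 t)))).
  by apply/funext => k; rewrite (cut_identity mgT k).
rewrite -(cvg_lim (@norm_hausdorff _ _) lim1) -(cvg_lim (@norm_hausdorff _ _) lim0).
by rewrite E.
Qed.

End growth_identity.

Variable g : (Lam -> R) -> R.
Hypothesis g_borel : borel_fun g.
Hypothesis g_growth : moderate_growth g.

Let gT (x : T) : R := g (of_tuple x).

Let mgT : measurable_fun setT gT.
Proof. exact: g_borel. Qed.

Let killed_integral i (u : Lam -> 'rV[R]_n.+1) : \bar R :=
  (\int[leb]_(t in `[0%R, +oo[)
    killed_expectation h P X0 i (half_sq_norms (theta s u))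
      (fun x l => (g l * (x == a)%:R)%R) t)%E.

(** The integrand of the killed expectation at fixed spins: [rho1] times g without the spin
    weight. *)
Let q (t : U) (v : mR * Om) : R := kill v * gT (Phi1 (t, v)).

Let mq : measurable_fun setT (fun z : U * (mR * Om) => q z.1 z.2).
Proof.
apply: measurable_funM; first exact: (measurableT_comp measurable_kill).
under eq_fun do rewrite -surjective_pairing.
exact: measurableT_comp.
Qed.

Let killed_integralE i t : killed_integral i (cfg t) =
  (\int[leb]_r fubini_F (P i) (EFin \o q t) r)%E.
Proof.
rewrite /killed_integral integral_mkcond; apply: eq_integral => r _.
rewrite /patch mem_setE in_itv/= andbT /fubini_F; case: ifPn => r0; last first.
  by rewrite integral0_eq// => w _; rewrite /= /q /kill/= (negbTE r0) !mul0r.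
rewrite /killed_expectation unlock; apply: eq_integral => w _ /=.
have lE : local_time X0 (half_sq_norms (theta s (cfg t))) r w =
    (fun i => ell t i + lam (r, w) i).
  by apply/funext => j; rewrite local_timeE.
congr (_%:E); rewrite lE /q /kill/= r0 mul1r /gT to_tupleK.
rewrite -(extend_leftE X0 w r0).
under eq_bigr do rewrite -/(ell t _) addrAC subrr add0r.
by ring.
Qed.

Let measurable_killed_integral i :
  measurable_fun setT (fun t : U => killed_integral i (cfg t)).
Proof.
under eq_fun do rewrite killed_integralE.
pose f (y : (U * mR) * Om) : \bar R := (q y.1.1 (y.1.2, y.2))%:E.
have mf : measurable_fun setT f.
  apply/measurable_EFinP.
  have h3 : measurable_fun setT (fun y : (U * mR) * Om => (y.1.1, (y.1.2, y.2))).
    apply: measurable_fun_pair; first exact: measurableT_comp.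
    by apply: measurable_fun_pair => //; exact: measurableT_comp.
  exact: (measurableT_comp mq h3).
have mf1 := measurable_fubini_F_ereal (P i) mf.
exact: (measurable_fubini_F_ereal leb mf1).
Qed.

(** Fubini makes the inner integrand integrable for almost every spin configuration only, so the two
    sides are compared almost everywhere. Dividing by the positive weight transfers integrability
    from the weighted integrand to [q], where Fubini is applied again to separate time from path. *)
Lemma bracket_killed_integral i :
  (mW i).-integrable setT (EFin \o (fun z => rho1 z * gT (Phi1 z))) ->
  bracket beta h (killed_integral i) =
  (\int[mW i]_z (rho1 z * gT (Phi1 z)))%:E.
Proof.
move=> imf; rewrite /Rintegral fineK; last exact: integrable_fin_num.
rewrite -(integral12_prod_meas1 imf) /bracket.
have mw : measurable_fun setT (fun t : U => (weight t)%:E).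
  by apply/measurable_EFinP; exact: measurable_weight.
apply: ae_eq_integral => //.
- by apply: emeasurable_funM => //; exact: measurable_killed_integral.
- by apply: measurable_fubini_F_ereal; exact: (measurable_int _ imf).
apply: filterS (ae_integrable1 imf) => t ift _.
have w0 : weight t != 0 by rewrite gt_eqF// expR_gt0.
have iq : (mV i).-integrable setT (EFin \o q t).
  have := integrableZl measurableT (weight t)^-1 ift.
  apply: eq_integrable => // v _ /=; rewrite -EFinM; congr (_%:E).
  by rewrite /rho1/= /q; field.
rewrite killed_integralE /fubini_F (integral12_prod_meas1 (m1 := leb) (m2 := P i) iq) muleC.
rewrite -integralZl//; apply: eq_integral => v _ /=; rewrite -EFinM; congr (_%:E).
by rewrite /rho1/= /q; ring.
Qed.

Lemma isomorphism :
  spin_expectation beta h (fun u : Lam -> 'rV[R]_n.+1 =>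
    (theta s u a 0 ord0 * g (half_sq_norms (theta s u)))%:E) =
  (s%:E * \sum_(i : Lam) ((h i)%:E * spin_expectation beta h (killed_integral i)))%E.
Proof.
have [C [k gC]] := g_growth.
have gT_growth l : `|gT (to_tuple l)| <= C * (1 + Num.sqrt (\sum_i l i ^+ 2)) ^+ k.
  by rewrite /gT to_tupleK.
have iw : mu.-integrable setT (EFin \o (fun t => weight t)).
  have := @integrable_poly_weight R Lam n beta h beta_ge0 h_ge0 beta_connected h_neq0
    (cst 1) 1 0 (measurable_cst _).
  have b (t : U) : `|cst 1 t| <= 1 * (1 + \sum_j tnth t j ^+ 2) ^+ 0 :> R.
    by rewrite expr0 mulr1 normr1.
  by move=> /(_ b); apply: eq_integrable => // t _ /=; rewrite mul1r.
pose Z := \int[mu]_t weight t.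
have ZE : bracket beta h (cst 1%E : (Lam -> 'rV[R]_n.+1) -> \bar R) = Z%:E.
  rewrite /Z /Rintegral fineK; last exact: integrable_fin_num.
  by apply: eq_integral => t _; rewrite mul1e.
have Z0 : Z != 0.
  rewrite gt_eqF// -lte_fin -ZE /bracket; under eq_integral do rewrite mul1e.
  apply: integral_tuple_gt0; first exact: measurable_weight.
  by move=> t; rewrite expR_gt0.
have divZ (x : R) : (x%:E / Z%:E = (x / Z)%:E)%E.
  by rewrite inver (negbTE Z0).
have i0 := integrable_rho0_growth mgT gT_growth.
rewrite /spin_expectation ZE.
have -> : bracket beta h (fun u : Lam -> 'rV[R]_n.+1 =>
    (theta s u a 0 ord0 * g (half_sq_norms (theta s u)))%:E) =
    (\int[mu]_t (rho0 t * gT (Phi0 t)))%:E.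
  rewrite /Rintegral fineK; last exact: integrable_fin_num.
  apply: eq_integral => t _; rewrite -EFinM; congr (_%:E).
  rewrite /rho0 /gT to_tupleK /theta !mxE/= mulr1.
  by ring.
rewrite divZ (growth_identity mgT gT_growth).
(* For s = 0, and below for h_i = 0, the bracket on the right is not known to be finite; the product
   with 0 is 0 in the extended reals. *)
have [->|s0] := eqVneq s 0; first by rewrite !mul0r mul0e.
have E i : ((h i)%:E * (bracket beta h (killed_integral i) / Z%:E) =
    (h i * (\int[mW i]_z (rho1 z * gT (Phi1 z)) / Z))%:E)%E.
  have := h_ge0 i; rewrite le_eqVlt => /predU1P[<-|hi]; first by rewrite mul0e mul0r.
  have i1 := integrable_rho1_growth mgT gT_growth s0 hi.
  by rewrite (bracket_killed_integral i1) divZ -EFinM.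
rewrite (eq_bigr _ (fun i _ => E i)).
rewrite sumEFin -EFinM -mulrA mulr_suml; congr ((_ * _)%:E).
by apply: eq_bigr => i _; rewrite mulrA.
Qed.

End isomorphism.

Unset Implicit Arguments.

Theorem theorem2p6 (R : realType) (Lam : finType) (n : nat)
    (beta : Lam -> Lam -> R) (h : Lam -> R)
    (beta_sym : forall i j, beta i j = beta j i)
    (beta_ge0 : forall i j, 0 <= beta i j)
    (beta_connected : forall i j, connect (fun x y => 0 < beta x y) i j)
    (h_ge0 : forall i, 0 <= h i)
    (h_neq0 : h <> (fun=> 0))
    (d : measure_display) (Om : measurableType d)
    (P : Lam -> probability Om R) (X : R -> Om -> Lam)
    (X_walk : random_walk beta P X)
    (g : (Lam -> R) -> R) (g_borel : borel_fun g) (g_growth : moderate_growth g)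
    (a : Lam) (s : R) :
  spin_expectation beta h (fun u : Lam -> 'rV[R]_n.+1 =>
    (theta s u a 0 ord0 * g (half_sq_norms (theta s u)))%:E) =
  (s%:E * \sum_(i : Lam) ((h i)%:E *
    spin_expectation beta h (fun u : Lam -> 'rV[R]_n.+1 =>
      \int[lebesgue_measure]_(t in `[0%R, +oo[)
        killed_expectation h P X i (half_sq_norms (theta s u))
          (fun x l => (g l * (x == a)%:R)%R) t)))%E.
Proof. exact: isomorphism. Qed.
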